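(* Suppose that the Basic Assumptions (a)-(c) hold with constants $f_{\mathrm{low}}$, $L_1>0$, $\sigma>0$ and $\alpha\in(1,2]$, and define $$\widetilde{M}_{1,\alpha}:= 2\big(f(x^0) - f_{\mathrm{low}} + \sigma^\alpha + L_1/2 + 3L_1^\alpha\big),\qquad \widehat{M}_{1,\alpha} := 2\big((\alpha-1)(2/\alpha)^{\alpha/(\alpha-1)} + 2\sigma^\alpha\big).$$ Let $\{x^k\}$ be generated by the normalized SFOM with Polyak momentum with input parameters $$\eta_k=\frac{1}{(k+1)^{3/4}},\qquad \theta_k=\frac{1}{(k+1)^{1/2}}\qquad\forall k\ge0.$$ Then, for any $\epsilon \in (0,1)$, it holds that $\mathbb{E}[\|\nabla f(x^{\iota_K})\|]\le \epsilon$ for all integers $K$ satisfying $$K\ge \max\Big\{\Big(\frac{16\widetilde{M}_{1,\alpha}}{\epsilon}\ln\Big(\frac{16\widetilde{M}_{1,\alpha}}{\epsilon}\Big)\Big)^{4},\Big(\frac{8\alpha\widehat{M}_{1,\alpha}}{(\alpha-1)\epsilon}\ln\Big(\frac{8\alpha\widehat{M}_{1,\alpha}}{(\alpha-1)\epsilon}\Big)\Big)^{2\alpha/(\alpha-1)},3\Big\},$$ where $\iota_K$ is uniformly drawn from $\{0,\ldots,K-1\}$.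
   Context: Setting. $\|\cdot\|$ is the Euclidean norm on $\mathbb{R}^n$. The function $f:\mathbb{R}^n\to\mathbb{R}$ is continuously differentiable and the problem $\min_{x\in\mathbb{R}^n} f(x)$ has at least one optimal solution. $\xi$ is a random variable with sample space $\Xi$, and $G:\mathbb{R}^n\times\Xi\to\mathbb{R}^n$ is a stochastic gradient estimator. Basic Assumptions. (a) There is a finite $f_{\mathrm{low}}$ with $f(x)\ge f_{\mathrm{low}}$ for all $x\in\mathbb{R}^n$. (b) There is $L_1>0$ with $\|\nabla f(x)-\nabla f(y)\|\le L_1\|x-y\|$ for all $x,y\in\mathbb{R}^n$. (c) $\mathbb{E}[G(x;\xi)]=\nabla f(x)$ and $\mathbb{E}[\|G(x;\xi)-\nabla f(x)\|^\alpha]\le\sigma^\alpha$ for all $x\in\mathbb{R}^n$, for some $\sigma>0$ and $\alpha\in(1,2]$. Normalized SFOM with Polyak momentum. Input: a starting point $x^0\in\mathbb{R}^n$, step sizes $\{\eta_k\}_{k\ge0}\subset(0,+\infty)$, weights $\{\theta_k\}_{k\ge0}\subset(0,1]$. Initialize $m^{-1}=0$, $\theta_{-1}=1$. For $k=0,1,2,\ldots$: $m^k=(1-\theta_{k-1})m^{k-1}+\theta_{k-1}G(x^k;\xi^k)$ and $x^{k+1}=x^k-\eta_k m^k/\|m^k\|$, where $\{\xi^k\}$ is a sequence of independently drawn samples of $\xi$. The iteration is understood to be well defined, i.e. $m^k\ne0$ for all $k$. The index $\iota_K$ is drawn independently of the algorithm's samples, so $\mathbb{E}[\|\nabla f(x^{\iota_K})\|]=\frac1K\sum_{k=0}^{K-1}\mathbb{E}[\|\nabla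 f(x^k)\|]$. *)

(* Defs.v *)
From mathcomp Require Import all_boot all_order all_algebra finmap.
From mathcomp Require Import all_classical all_reals all_analysis.

Set Implicit Arguments.
Unset Strict Implicit.
Unset Printing Implicit Defensive.

Import Order.TTheory GRing.Theory Num.Theory.
Import numFieldNormedType.Exports.

Local Open Scope classical_set_scope.
Local Open Scope ring_scope.

(* The canonical norm on ['rV[R]_n] is the sup norm; the topology,
   differentiability and Borel sets are the same for both norms. *)
Definition enorm (R : realType) (n : nat) (v : 'rV[R]_n) : R :=
  Num.sqrt (\sum_(i < n) v ord0 i ^+ 2).

Definition grad (R : realType) (n : nat) (f : 'rV[R]_n -> R) (x : 'rV[R]_n) :
    'rV[R]_n :=
  \row_(i < n) 'D_(delta_mx ord0 i : 'rV[R]_n) f x.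

Definition continuously_differentiable (R : realType) (n : nat)
    (f : 'rV[R]_n -> R) : Prop :=
  (forall x, differentiable f x) /\ continuous (grad f).

Definition borel_rV (R : realType) (n : nat) :=
  g_sigma_algebraType (@open 'rV[R]_n).

Definition jointly_measurable (R : realType) (n : nat) (d : measure_display)
    (Xi : measurableType d) (G : 'rV[R]_n -> Xi -> 'rV[R]_n) : Prop :=
  measurable_fun [set: borel_rV R n * Xi]
    (fun z : borel_rV R n * Xi => G z.1 z.2 : borel_rV R n).

Section independence.
Local Open Scope ereal_scope.
Context (d d' : measure_display) (T : measurableType d)
  (Xi : measurableType d') (R : realType) (P : probability T R).

Definition mutually_independent (X : nat -> {RV P >-> Xi}) : Prop :=
  forall (J : {fset nat}) (A : nat -> set Xi),
    (forall j, j \in J -> measurable (A j)) ->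
    P (\bigcap_(j in [set` J]) (X j @^-1` A j)) =
    \prod_(j <- J) P (X j @^-1` A j).

Definition identically_distributed (X Y : {RV P >-> Xi}) : Prop :=
  forall A, measurable A -> distribution P X A = distribution P Y A.

Definition sigma_sequence (X : nat -> {RV P >-> Xi}) : set_system T :=
  <<s \bigcup_k preimage_set_system [set: T] (X k) measurable >>.

Definition independent_of_sequence (iota : {RV P >-> nat})
    (X : nat -> {RV P >-> Xi}) : Prop :=
  forall (A : set nat) (E : set T), sigma_sequence X E ->
    P (iota @^-1` A `&` E) = P (iota @^-1` A) * P E.

(* When [0 < K] these [K] probabilities sum to 1, so [iota < K] almost surely. *)
Definition uniform_index (K : nat) (iota : {RV P >-> nat}) : Prop :=
  forall j : nat, (j < K)%N -> P (iota @^-1` [set j]) = (K%:R^-1 : R)%:E.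

End independence.

Section polyak_momentum.
Context (R : realType) (n : nat) (Xi : Type).
Variables (G : 'rV[R]_n -> Xi -> 'rV[R]_n) (eta theta : nat -> R).
Variables (x0 : 'rV[R]_n) (s : nat -> Xi).

(* [theta_pred k] is the weight of index [k - 1], equal to 1 for index -1. *)
Definition theta_pred (k : nat) : R := if k is j.+1 then theta j else 1.

(* [pm_state k] is the pair of the [k]-th iterate and of the momentum of index
   [k - 1], the momentum of index -1 being 0.  A zero momentum, for which the
   step is undefined on paper, leaves the iterate unchanged here. *)
Fixpoint pm_state (k : nat) : 'rV[R]_n * 'rV[R]_n :=
  if k is j.+1 then
    let x := (pm_state j).1 in
    let m := (1 - theta_pred j) *: (pm_state j).2
             + theta_pred j *: G x (s j) in
    (x - (eta j / enorm m) *: m, m)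
  else (x0, 0).

Definition pm_iterate (k : nat) : 'rV[R]_n := (pm_state k).1.

Definition pm_momentum (k : nat) : 'rV[R]_n := (pm_state k.+1).2.

End polyak_momentum.

Definition M_tilde (R : realType) (gap L1 sigma alpha : R) : R :=
  2 * (gap + sigma `^ alpha + L1 / 2 + 3 * L1 `^ alpha).

Definition M_hat (R : realType) (sigma alpha : R) : R :=
  2 * ((alpha - 1) * (2 / alpha) `^ (alpha / (alpha - 1))
       + 2 * sigma `^ alpha).

(* Main.v *)
From HB Require Import structures.
Require Import Defs.
From mathcomp Require Import all_boot all_order all_algebra finmap.
From mathcomp Require Import all_classical all_reals all_analysis.
From mathcomp Require Import measurable_realfun.
From mathcomp Require Import ring lra.

Set Implicit Arguments.
Unset Strict Implicit.
Unset Printing Implicit Defensive.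

Import Order.TTheory GRing.Theory Num.Theory.
Import numFieldNormedType.Exports.

Local Open Scope classical_set_scope.
Local Open Scope ring_scope.

(** The potential [f (x k) - f_low + p k * enorm (m k - grad f (x k)) `^ alpha], with
weights [p k] that decrease polynomially, falls in expectation by that of
[eta k * enorm (grad f (x k))] at every step, up to costs whose sum grows slowly.

Two inequalities give this. First, a step along the normalized momentum decreases
[f] by [eta k * enorm (grad f (x k))], up to twice [eta k] times the momentum error
and a curvature term ([descent_normalized]); Young's inequality trades the linear
error for [theta k * p k] times its [alpha]-th power plus a deterministic remainder
([gapS_le]). Second, the expected [alpha]-th power of the error contracts by
[1 - theta k] at every step, up to a drift of the gradient and a noise term
([errS_le]). The noise term rests on
[|a + b|^alpha <= |a|^alpha + alpha |a|^(alpha - 2) <a, b> + 2 |b|^alpha]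
([enorm_powR_normD]): the noise is independent of the past and has mean zero, so the
middle term disappears on average and only the [alpha]-th moment of the noise
remains. Conditioning is done by proving that the law of the pair (past state, new
sample) is a product ([past_independent], [integral_independent_le]). Weighting the
second inequality by [p k] and adding it to the first, the contraction pays exactly
for the power produced by Young's inequality, and the sum telescopes
([potential_telescope]). The expectations that enter this sum are those of nonnegative
functions, and they are compared in the extended reals.

The exponent of [p k] is chosen so that the remainder of Young's inequality and the
noise term have the same order. The total cost up to [K], initial gap included, is
then at most [ln K * (Mt + Mh * K^((2 - alpha) / (4 * alpha)))] ([step_cost_le],
[harmonic_le_ln], [total_cost_le]), where [3 <= K] ensures [1 <= ln K]. As every step
size is at least [K^(-3/4)], the average gradient norm is at most
[ln K * (Mt * K^(-1/4) + Mh * K^(-(alpha - 1) / (2 * alpha)))], and the other two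
parts of the threshold on [K] make both terms at most [eps / 2] ([log_rate_le]).
Finally, the random index is independent of all samples, so the expectation at this
index is that average ([expectation_random_index]). *)

(** * Scalar inequalities *)

Section scalar_inequalities.
Context {R : realType}.
Implicit Types c p t u v w x y A alpha : R.

Lemma powR_mulD x p q : 0 < x -> x `^ p * x `^ q = x `^ (p + q).
Proof. by move=> x0; rewrite powRD// (gt_eqF x0) implybT. Qed.

(** Concavity of [x `^ p], as a tangent line. After division by [y `^ p] this is
[expR (p * l) <= 1 - p + p * expR l], a convex combination of two instances of
[1 + x <= expR x]. *)
Lemma powR_tangent p x y : 0 <= p -> p <= 1 -> 0 <= x -> 0 < y ->
  x `^ p <= y `^ p + p * y `^ (p - 1) * (x - y).
Proof.
move=> p0 p1 x0 y0.
have yE : y `^ (p - 1) * y = y `^ p.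
  by rewrite -[X in _ * X](powRr1 (ltW y0)) powR_mulD// subrK.
have py0 := powR_ge0 y p.
rewrite mulrBr -[p * _ * y]mulrA yE.
have [x_eq0|xN0] := eqVneq x 0.
  rewrite x_eq0 mulr0 sub0r; have [->|pN0] := eqVneq p 0.
    by rewrite !powRr0 mul0r subr0.
  by rewrite powR0//; have := mulr_ge0 p0 py0; have := ler_wpM2r py0 p1; lra.
have {xN0}x_gt0 : 0 < x by rewrite lt_neqAle eq_sym xN0.
pose l := ln x - ln y; pose e := expR (p * l).
have xpE : x `^ p = y `^ p * e.
  by rewrite /powR !gt_eqF//= -expRD /l; congr expR; ring.
have xE : y `^ (p - 1) * x = y `^ p * (e * expR ((1 - p) * l)).
  rewrite -yE -mulrA; congr (_ * _); rewrite /e -!expRD -[X in X * _]lnK//.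
  by rewrite -expRD -[LHS]lnK//; congr expR; rewrite /l; ring.
have oneE : e * expR (- (p * l)) = 1 by rewrite /e -expRD subrr expR0.
have e0 : 0 < e := expR_gt0 _.
have h1 := expR_ge1Dx ((1 - p) * l); have h2 := expR_ge1Dx (- (p * l)).
rewrite -[p * _ * x]mulrA xE xpE.
set E1 := expR ((1 - p) * l) in h1 *; set E2 := expR _ in h2 oneE.
suff : e <= 1 + p * (e * E1) - p.
  by move=> /(ler_wpM2l py0); clearbody e E1; clear; lra.
have k1 : e * (1 + (1 - p) * l) <= e * E1 by rewrite ler_pM2l.
have k2 : e * (1 - p * l) <= 1 by rewrite -[leRHS]oneE ler_pM2l.
have q0 : 0 <= 1 - p by lra.
have := ler_wpM2l p0 k1; have := ler_wpM2l q0 k2.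
clear -e0; clearbody e E1 l => *; lra.
Qed.

(** Here [u], [v], [w] are the norms of vectors [a], [b], [a + b], and [c] is the
inner product of [a] and [b]. Since [alpha / 2 <= 1], the power
[w `^ alpha = (w ^+ 2) `^ (alpha / 2)] lies below its tangents in the variable
[w ^+ 2]: the tangent at [u ^+ 2] suffices when [v <= u], and the one at [v ^+ 2]
otherwise. *)
Lemma powR_normD_expand alpha u v c w : 1 < alpha -> alpha <= 2 ->
  0 <= u -> 0 <= v -> 0 <= w -> `|c| <= u * v ->
  w ^+ 2 = u ^+ 2 + 2 * c + v ^+ 2 ->
  w `^ alpha <= u `^ alpha + alpha * u `^ (alpha - 2) * c + 2 * v `^ alpha.
Proof.
move=> a1 a2 u0 v0 w0 /ler_normlP[cl cr] wE.
have vp0 := powR_ge0 v alpha; have up0 := powR_ge0 u alpha.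
have sqr_powR x (q : R) : 0 <= x -> (x ^+ 2) `^ q = x `^ (2 * q).
  by move=> x0; rewrite -powR_mulrn// -powRrM.
have h0 : 0 <= alpha / 2 by lra.
have h1 : alpha / 2 <= 1 by lra.
have wpE : w `^ alpha = (w ^+ 2) `^ (alpha / 2).
  by rewrite sqr_powR//; congr (_ `^ _); field.
have tang z : 0 < z ->
    w `^ alpha <= z `^ alpha + alpha / 2 * z `^ (alpha - 2) * (w ^+ 2 - z ^+ 2).
  move=> z0; have := powR_tangent h0 h1 (sqr_ge0 w) (exprn_gt0 2 z0).
  rewrite -wpE !sqr_powR ?(ltW z0)//.
  have -> : 2 * (alpha / 2) = alpha by field.
  by have -> : 2 * (alpha / 2 - 1) = alpha - 2 by field.
have powE x (q s : R) : 0 < x -> s = q + 1 -> x `^ s = x `^ q * x.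
  by move=> x0 ->; rewrite -powR_mulD// powRr1// ltW.
have [u_eq0|uN0] := eqVneq u 0.
  have c0 : c = 0 by rewrite u_eq0 mul0r in cl cr; lra.
  have wv : w = v.
    apply/eqP; rewrite -(eqrXn2 (n := 2))//; apply/eqP.
    by rewrite wE u_eq0 c0; ring.
  by rewrite wv c0 mulr0; lra.
have {uN0}u_gt0 : 0 < u by rewrite lt_neqAle eq_sym uN0.
have [vu|uv] := leP v u.
  (* the second-order term is at most [v `^ alpha], as [alpha - 2 <= 0] *)
  have [v_eq0|vN0] := eqVneq v 0.
    by have := tang u u_gt0; rewrite wE v_eq0 powR0; [nra|lra].
  have v_gt0 : 0 < v by rewrite lt_neqAle eq_sym vN0.
  have up2 : u `^ (alpha - 2) * v ^+ 2 <= v `^ alpha.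
    rewrite -(powR_mulrn 2 v0).
    have -> : v `^ alpha = v `^ (alpha - 2) * v `^ 2 by rewrite powR_mulD// subrK.
    rewrite ler_wpM2r ?powR_ge0//.
    rewrite (_ : alpha - 2 = - (2 - alpha)); last by ring.
    rewrite !powRN lef_pV2 ?posrE ?powR_gt0//.
    by rewrite ge0_ler_powR ?nnegrE//; lra.
  have h := tang u u_gt0; rewrite wE in h.
  have up20 := powR_ge0 u (alpha - 2).
  have : alpha / 2 * (u `^ (alpha - 2) * v ^+ 2) <= 1 * v `^ alpha.
    by apply: ler_pM => //; apply: mulr_ge0 => //; exact: sqr_ge0.
  move: h vp0; move: (u `^ (alpha - 2)) (u `^ alpha) (v `^ alpha) (w `^ alpha).
  by clear => *; lra.
have v_gt0 : 0 < v by exact: le_lt_trans uv.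
have h := tang v v_gt0; rewrite wE in h.
set U2 := u `^ (alpha - 2) in h *; set V2 := v `^ (alpha - 2) in h *.
have U20 : 0 <= U2 := powR_ge0 _ _; have V20 : 0 <= V2 := powR_ge0 _ _.
have U1E : u `^ (alpha - 1) = U2 * u by apply: powE => //; ring.
have V1E : v `^ (alpha - 1) = V2 * v by apply: powE => //; ring.
have UE : u `^ alpha = U2 * u * u by rewrite -U1E; apply: powE => //; ring.
have VE : v `^ alpha = V2 * v * v by rewrite -V1E; apply: powE => //; ring.
(* the coefficient of [c] in the tangent at [v ^+ 2] is [alpha * V2]; replacing it
   by [alpha * U2] costs at most [alpha * (U2 - V2) * (u * v)] *)
have V2U2 : V2 <= U2.
  rewrite /U2 /V2 (_ : alpha - 2 = - (2 - alpha)); last by ring.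
  rewrite !powRN lef_pV2 ?posrE ?powR_gt0//.
  by rewrite ge0_ler_powR ?nnegrE//; lra.
have t1 : U2 * u <= V2 * v + (alpha - 1) * V2 * (u - v).
  have := @powR_tangent (alpha - 1) u v _ _ u0 v_gt0.
  rewrite U1E V1E (_ : alpha - 1 - 1 = alpha - 2); last by ring.
  by apply; lra.
have c1 : (U2 - V2) * - (u * v) <= (U2 - V2) * c.
  by apply: ler_wpM2l; [rewrite subr_ge0|lra].
have t2 : alpha * v * (U2 * u) <= alpha * v * (V2 * v + (alpha - 1) * V2 * (u - v)).
  by apply: ler_wpM2l t1; apply: mulr_ge0; lra.
have uu : V2 * (u * u) <= U2 * (u * u).
  by rewrite ler_wpM2r// mulr_ge0.
rewrite UE VE; apply: le_trans h _; rewrite VE.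
have vv0 : 0 <= V2 * (v * v) by rewrite !mulr_ge0.
have uv0 : 0 <= V2 * (u * v) by rewrite !mulr_ge0.
have A1 : 0 <= (2 - alpha) * (alpha * (V2 * (u * v))).
  by rewrite mulr_ge0// ?mulr_ge0//; lra.
have A2 : 0 <= (alpha - 1) ^+ 2 * (V2 * (v * v)) by rewrite mulr_ge0// sqr_ge0.
have A3 : alpha / 2 * (V2 * (u * u)) <= 1 * (V2 * (u * u)).
  by apply: ler_wpM2r => //; rewrite !mulr_ge0.
have A4 : alpha * ((U2 - V2) * - (u * v)) <= alpha * ((U2 - V2) * c).
  by apply: ler_wpM2l c1; lra.
by lra.
Qed.

(** Optimal form of Young's inequality: the right-hand side minus the left-hand
one is minimal, and zero, at [t `^ (alpha - 1) = 2 * h / (c * alpha)]. *)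
Lemma young_powR alpha c h t : 1 < alpha -> 0 < c -> 0 < h -> 0 <= t ->
  2 * h * t <= c * t `^ alpha
    + (alpha - 1) * (2 / alpha) `^ (alpha / (alpha - 1))
      * (h `^ (alpha / (alpha - 1)) * c `^ (- (1 / (alpha - 1)))).
Proof.
move=> a1 c0 h0 t0; set q := alpha / (alpha - 1).
have a0 : 0 < alpha by lra.
have b0 : 0 < alpha - 1 by lra.
have [a0' b0'] : alpha != 0 /\ alpha - 1 != 0 by rewrite !gt_eqF.
have q0 : 0 < q by rewrite divr_gt0.
(* the scaling [r] makes the first term of [conjugate_powR] equal to
   [c * t `^ alpha] *)
pose r := (c * alpha) `^ alpha^-1.
have r0 : 0 < r by rewrite powR_gt0// mulr_gt0.
have r0' : r != 0 by rewrite gt_eqF.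
have pq : alpha^-1 + q^-1 = 1 by rewrite /q; field; rewrite ?a0' ?b0'.
have := @conjugate_powR _ (r * t) (2 * h / r) alpha q (mulr_ge0 (ltW r0) t0).
move=> /(_ (ltW (divr_gt0 (mulr_gt0 _ h0) r0)) a0 q0 pq).
rewrite (_ : r * t * _ = 2 * h * t); last by field.
move=> /(_ (ltr0n _ 2)) /le_trans; apply; apply: lerD.
  rewrite (powRM _ (ltW r0) t0) /r -powRrM mulVf// powRr1; last exact/ltW/mulr_gt0.
  by rewrite le_eqVlt; apply/orP; left; apply/eqP; field.
rewrite powRM ?invr_ge0 ?(ltW r0)//; last by lra.
rewrite powRM//; [|lra..].
rewrite -[r^-1]powR_inv1 ?(ltW r0)// /r -!powRrM.
rewrite powRM//; [|lra..].
rewrite [(2 / alpha) `^ _]powRM// ?invr_ge0 ?(ltW a0)//.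
rewrite -[alpha^-1 in leRHS]powR_inv1 ?(ltW a0)// -powRrM.
have -> : alpha^-1 * (-1 * q) = - (1 / (alpha - 1)) :> R.
  by rewrite /q; field; rewrite ?a0' ?b0'.
have -> : q^-1 = (alpha - 1) * alpha `^ (-1).
  by rewrite powR_inv1 ?(ltW a0)// /q; field; rewrite ?a0' ?b0'.
have -> : -1 * q = -1 + - (1 / (alpha - 1)) by rewrite /q; field.
by rewrite -powR_mulD// le_eqVlt; apply/orP; left; apply/eqP; ring.
Qed.

Lemma powR_convex2 alpha t x y : 1 <= alpha -> 0 <= t -> t <= 1 -> 0 <= x -> 0 <= y ->
  ((1 - t) * x + t * y) `^ alpha <= (1 - t) * x `^ alpha + t * y `^ alpha.
Proof.
move=> a1 t0 t1 x0 y0.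
have := @convex_powR R alpha a1 (Itv01 t0 t1) y x.
rewrite !inE /= !in_itv /= !andbT => /(_ y0 x0).
rewrite !convRE /= /unstable.onem => h.
rewrite [(1 - t) * x + _]addrC [leRHS]addrC.
by apply: le_trans h; rewrite [X in _ <= X `^ _]convRE.
Qed.

(** From [1 - 1 / 6 <= expR (- (1 / 6))] one gets [expR 1 <= (6 / 5) ^+ 6 < 3]. *)
Lemma expR1_le3 : expR 1 <= 3 :> R.
Proof.
have h := expR_ge1Dx (- (1 / 6) : R).
have e0 : 0 < expR (1 / 6 : R) := expR_gt0 _.
have e6 : expR (1 / 6 : R) <= 6 / 5.
  have : expR (1 / 6 : R) * expR (- (1 / 6)) = 1 by rewrite -expRD subrr expR0.
  by move: (expR _) (expR _) h e0 => E1 E2 h e0; nra.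
have -> : 1 = 6%:R * (1 / 6) :> R by field.
rewrite expRM_natl; apply: (@le_trans _ _ ((6 / 5) ^+ 6)); last by lra.
by rewrite lerXn2r ?nnegrE ?(ltW e0)//; lra.
Qed.

Lemma ln_ge1 x : 3 <= x -> 1 <= ln x.
Proof.
move=> x3; rewrite -ler_expR lnK ?posrE; last by lra.
exact: le_trans expR1_le3 x3.
Qed.

(** The tangent of [ln] at [A] gives [ln u <= u / A - 1 + ln A], and the hypothesis
bounds [ln A] by [u / A]. *)
Lemma ln_le_of_ge_mul_ln A u : 0 < A -> 0 < u -> A * ln A <= u ->
  ln u <= 2 * u / A.
Proof.
move=> A0 u0 Au.
have uA0 : 0 < u / A by rewrite divr_gt0.
have : ln u = ln (u / A) + ln A by rewrite -lnM ?posrE// divfK// gt_eqF.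
have := @le_ln1Dx R (u / A - 1); rewrite subrKC => /(_ _).
have : ln A <= u / A by rewrite ler_pdivlMr// mulrC.
move=> h1 h2 ->; have {}h2 := h2 _; rewrite -mulrA.
by have : ln (u / A) <= u / A - 1; [apply: h2; lra|lra].
Qed.

Lemma harmonic_le_ln K : (0 < K)%N ->
  \sum_(k < K) (k.+1%:R)^-1 <= 1 + ln (K%:R) :> R.
Proof.
elim: K => // -[|K] IH _.
  by rewrite big_ord_recr big_ord0 /= add0r ln1 invr1 addr0.
rewrite big_ord_recr /=; set x : R := K.+1%:R; set y : R := K.+2%:R.
have x0 : 0 < x by rewrite ltr0n.
have y0 : 0 < y by rewrite ltr0n.
have xy : y = x + 1 by rewrite /y -natr1.
have l : ln x <= ln y - y^-1.
  have -> : ln x = ln (1 + - y^-1) + ln y.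
    rewrite -lnM ?posrE//; last by rewrite subr_gt0 invf_lt1// xy; lra.
    by congr ln; rewrite mulrDl mulNr mulVf ?gt_eqF// xy; ring.
  rewrite addrC lerD2l; apply: le_ln1Dx.
  by rewrite ltrN2 invf_lt1// xy; lra.
apply: le_trans (lerD (IH isT) (lexx _)) _; rewrite -/x -addrA lerD2l.
by rewrite -lerBrDr.
Qed.

End scalar_inequalities.

(** * Euclidean geometry and the descent inequality *)

Section euclidean_space.
Context {R : realType} {n : nat}.
Implicit Types (u v w x : 'rV[R]_n) (a : R).

Definition dotp u v : R := \sum_(i < n) u ord0 i * v ord0 i.

Lemma dotpC u v : dotp u v = dotp v u.
Proof. by apply: eq_bigr => i _; rewrite mulrC. Qed.

Lemma dotpDl u v w : dotp (u + v) w = dotp u w + dotp v w.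
Proof. by rewrite -big_split; apply: eq_bigr => i _; rewrite mxE mulrDl. Qed.

Lemma dotpZl a u w : dotp (a *: u) w = a * dotp u w.
Proof. by rewrite mulr_sumr; apply: eq_bigr => i _; rewrite mxE mulrA. Qed.

Lemma dotpNl u w : dotp (- u) w = - dotp u w.
Proof. by rewrite -scaleN1r dotpZl mulN1r. Qed.

Lemma dotpDr u v w : dotp u (v + w) = dotp u v + dotp u w.
Proof. by rewrite dotpC dotpDl !(dotpC u). Qed.

Lemma dotpZr a u w : dotp u (a *: w) = a * dotp u w.
Proof. by rewrite dotpC dotpZl (dotpC u). Qed.

Lemma dotpNr u w : dotp u (- w) = - dotp u w.
Proof. by rewrite dotpC dotpNl (dotpC u). Qed.

Lemma enorm_ge0 u : 0 <= enorm u.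
Proof. exact: sqrtr_ge0. Qed.

Lemma dotpp u : dotp u u = enorm u ^+ 2.
Proof.
by rewrite sqr_sqrtr ?sumr_ge0// => i _; exact: sqr_ge0.
Qed.

Lemma enorm_sqrD u v :
  enorm (u + v) ^+ 2 = enorm u ^+ 2 + 2 * dotp u v + enorm v ^+ 2.
Proof. by rewrite -!dotpp !dotpDl !dotpDr (dotpC v u); ring. Qed.

Lemma enormZ a u : enorm (a *: u) = `|a| * enorm u.
Proof.
apply/eqP; rewrite -(eqrXn2 (n := 2)) ?enorm_ge0//; last first.
  by rewrite mulr_ge0// enorm_ge0.
by rewrite exprMn -!dotpp dotpZl dotpZr mulrA real_normK// num_real.
Qed.

Lemma enorm0 : enorm (0 : 'rV[R]_n) = 0.
Proof. by rewrite -[X in enorm X](scale0r 0) enormZ normr0 mul0r. Qed.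

Lemma enormN u : enorm (- u) = enorm u.
Proof. by rewrite -scaleN1r enormZ normrN1 mul1r. Qed.

Lemma enorm_sub u v : enorm (u - v) = enorm (v - u).
Proof. by rewrite -enormN opprB. Qed.

Lemma ler_coord_enorm u i : `|u ord0 i| <= enorm u.
Proof.
rewrite -sqrtr_sqr; apply: ler_wsqrtr; rewrite (bigD1 i)//= lerDl sumr_ge0//.
by move=> j _; exact: sqr_ge0.
Qed.

Lemma cauchy_schwarz u v : `|dotp u v| <= enorm u * enorm v.
Proof.
have [v0|vN0] := eqVneq (enorm v) 0.
  suff -> : dotp u v = 0 by rewrite normr0 mulr_ge0 ?enorm_ge0.
  apply: big1 => i _; have := ler_coord_enorm v i.
  by rewrite v0 normr_le0 => /eqP ->; rewrite mulr0.
have v0 : 0 < enorm v by rewrite lt_neqAle eq_sym vN0 enorm_ge0.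
rewrite -ler_sqr ?nnegrE ?mulr_ge0 ?enorm_ge0// real_normK ?num_real// exprMn.
(* up to the factor [enorm v ^+ 2], the component of [u] orthogonal to [v] *)
have := sqr_ge0 (enorm ((enorm v ^+ 2) *: u + (- dotp u v) *: v)).
rewrite enorm_sqrD !enormZ !exprMn !real_normK ?num_real// dotpZl dotpZr.
move: (enorm v) (enorm u) (dotp u v) v0 => b a c b0 h.
have : 0 <= b ^+ 2 * (a ^+ 2 * b ^+ 2 - c ^+ 2) by apply: le_trans h _; clear; lra.
by rewrite pmulr_rge0 ?exprn_gt0// subr_ge0.
Qed.

Lemma ler_enormD u v : enorm (u + v) <= enorm u + enorm v.
Proof.
rewrite -ler_sqr ?nnegrE ?addr_ge0 ?enorm_ge0// enorm_sqrD sqrrD.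
have := cauchy_schwarz u v; have := ler_norm (dotp u v).
by lra.
Qed.

Lemma enorm_powR_normD alpha u v : 1 < alpha -> alpha <= 2 ->
  enorm (u + v) `^ alpha <= enorm u `^ alpha
    + alpha * enorm u `^ (alpha - 2) * dotp u v + 2 * enorm v `^ alpha.
Proof.
move=> a1 a2; apply: powR_normD_expand; rewrite ?enorm_ge0//.
  exact: cauchy_schwarz.
exact: enorm_sqrD.
Qed.

Variable f : 'rV[R]_n -> R.
Hypothesis f_diff : forall x, differentiable f x.

Lemma derive_dotp_grad x v : 'D_v f x = dotp (grad f x) v.
Proof.
rewrite deriveE// [v in LHS]row_sum_delta linear_sum; apply: eq_bigr => i _.
by rewrite linearZ /= -deriveE// mxE mulrC.
Qed.

Lemma is_derive_line x v (t : R) :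
  is_derive t 1 (fun s => f (x + s *: v)) (dotp (grad f (x + t *: v)) v).
Proof.
have E : (fun h : R => h^-1 *: ((f \o shift (x + t *: v)) (h *: v) - f (x + t *: v)))
  = (fun h : R => h^-1 *: (((fun s => f (x + s *: v)) \o shift t) (h *: (1 : R))
       - f (x + t *: v))).
  apply/funext => h /=; congr (_ *: (f _ - _)).
  by rewrite addrCA; congr (_ + _); rewrite -scalerDl; congr (_ *: _);
     rewrite /GRing.scale /= mulr1 addrC.
have := @diff_derivable _ _ _ f (x + t *: v) v (f_diff _).
rewrite -derive_dotp_grad /derivable /derive E => h.
exact: DeriveDef.
Qed.

Variables (L : R) (L_ge0 : 0 <= L).
Hypothesis grad_lip : forall x y, enorm (grad f x - grad f y) <= L * enorm (x - y).

Lemma quadratic_upper_bound x v :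
  f (x + v) <= f x + dotp (grad f x) v + L / 2 * enorm v ^+ 2.
Proof.
pose A := dotp (grad f x) v; pose B := L / 2 * enorm v ^+ 2.
(* the defect of the bound along the segment, nonincreasing by [grad_lip] *)
pose g : R -> R := (fun s => f (x + s *: v)) - (A \*: id + B \*: (id ^+ 2)).
pose dg (t : R) := dotp (grad f (x + t *: v)) v - (A + B * (2 * t)).
have dgP t : is_derive t (1 : R) g (dg t).
  apply: is_deriveB; first exact: is_derive_line.
  apply: is_derive_eq; rewrite /GRing.scale /=; ring.
have gc : {within `[0, 1], continuous g}.
  by apply: derivable_within_continuous => t _; have [] := dgP t.
have [c] := @MVT_segment _ g dg 0 1 ler01 (fun t _ => dgP t) gc.
rewrite in_itv /= => /andP[c0 c1]; rewrite subr0 mulr1.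
have dg0 : dg c <= 0.
  have : dotp (grad f (x + c *: v) - grad f x) v <= c * (L * enorm v ^+ 2).
    apply: le_trans (ler_norm _) _; apply: le_trans (cauchy_schwarz _ _) _.
    rewrite expr2 !mulrA ler_wpM2r ?enorm_ge0//.
    apply: le_trans (grad_lip _ _) _.
    by rewrite addrC addKr enormZ ger0_norm// mulrCA mulrA.
  by rewrite dotpDl dotpNl /dg -/A /B; clear; lra.
have g0 : g 0 = f x - (A * 0 + B * 0 ^+ 2).
  by rewrite -[X in f X](addr0 x) -[X in x + X](scale0r v).
have g1 : g 1 = f (x + v) - (A * 1 + B * 1 ^+ 2).
  by rewrite -[X in f (x + X)](scale1r v).
rewrite g0 g1 -/A -/B => gE; move: dg0; rewrite -gE; clear; lra.
Qed.

(** Moving along [m] instead of [grad f x] loses at most twice the error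
[m - grad f x]: once in the inner product with the unit direction of [m], once in
comparing [enorm m] with [enorm (grad f x)]. *)
Lemma descent_normalized x m (h : R) : 0 <= h ->
  f (x - (h / enorm m) *: m) + h * enorm (grad f x) <=
  f x + 2 * h * enorm (m - grad f x) + L / 2 * h ^+ 2.
Proof.
move=> h0; have := quadratic_upper_bound x (- (h / enorm m) *: m).
rewrite scaleNr => dsc; apply: le_trans (lerD dsc (lexx _)) _.
have tri : enorm (grad f x) <= enorm m + enorm (m - grad f x).
  by rewrite enorm_sub -[X in enorm X <= _](subrKC m); exact: ler_enormD.
have d0 := enorm_ge0 (m - grad f x); have g0 := enorm_ge0 (grad f x).
(* a zero momentum: the step is void and the error is the whole gradient *)
have [m0|mN0] := eqVneq (enorm m) 0.
  rewrite m0 invr0 mulr0 scale0r oppr0 enorm0.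
  have z : (0 : R) ^+ 2 = 0 by rewrite expr0n.
  rewrite z {z}.
  have -> : dotp (grad f x) 0 = 0.
    by apply: big1 => i _; rewrite [X in _ * X]mxE mulr0.
  have : h * enorm (grad f x) <= h * enorm (m - grad f x).
    by rewrite ler_wpM2l//; rewrite m0 add0r in tri.
  have := mulr_ge0 h0 d0; have := mulr_ge0 L_ge0 (sqr_ge0 h).
  by clear; lra.
rewrite dotpNr enormN dotpZr enormZ exprMn ger0_norm; last first.
  by rewrite divr_ge0// enorm_ge0.
rewrite -exprMn divfK//.
have : - (h / enorm m * dotp (grad f x) m)
       <= - h * enorm m + h * enorm (m - grad f x).
  have -> : dotp (grad f x) m = enorm m ^+ 2 - dotp (m - grad f x) m.
    by rewrite dotpDl dotpNl dotpp; ring.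
  have cs := le_trans (ler_norm _) (cauchy_schwarz (m - grad f x) m).
  have m_gt0 : 0 < enorm m by rewrite lt_neqAle eq_sym mN0 enorm_ge0.
  have -> : h / enorm m * (enorm m ^+ 2 - dotp (m - grad f x) m)
    = h * enorm m - h / enorm m * dotp (m - grad f x) m by field.
  have : h / enorm m * dotp (m - grad f x) m <= h * enorm (m - grad f x).
    by rewrite -mulrA ler_wpM2l// mulrC ler_pdivrMr.
  by clear; lra.
have := ler_wpM2l h0 tri; clear; lra.
Qed.

End euclidean_space.

(** * Borel measurability of the iterates *)

Section borel_measurability.
Context {R : realType} {n : nat}.

Lemma open_measurable_borel_rV (U : set 'rV[R]_n) :
  open U -> measurable (U : set (borel_rV R n)).
Proof. exact: sub_sigma_algebra. Qed.

Lemma continuous_measurable_borel_rV (g : 'rV[R]_n -> R) :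
  continuous g -> measurable_fun setT (g : borel_rV R n -> R).
Proof.
move=> cg; apply: (measurability (@RGenOInfty.G R)).
  exact: RGenOInfty.measurableE.
move=> _ [_ [x ->] <-]; rewrite setTI; apply: open_measurable_borel_rV.
rewrite (_ : g @^-1` _ = g @^-1` [set y | x < y]); last first.
  by apply/seteqP; split => y /=; rewrite in_itv /= andbT.
by move/continuousP : cg; apply; exact: open_gt.
Qed.

Lemma measurable_coord (i : 'I_n) :
  measurable_fun setT (fun v : borel_rV R n => (v : 'rV[R]_n) ord0 i).
Proof. by apply: continuous_measurable_borel_rV; exact: coord_continuous. Qed.

(** The rational points with balls of radius [1 / (k + 1)] form a countable base
of the topology, so the Borel sets are generated by the coordinates. *)
Lemma measurable_fun_rV d (T : measurableType d) (g : T -> 'rV[R]_n) :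
  (forall i, measurable_fun setT (fun w => g w ord0 i)) ->
  measurable_fun setT (g : T -> borel_rV R n).
Proof.
move=> mg; apply: (@measurability _ _ _ (borel_rV R n) _ _ (@open 'rV[R]_n)) => //.
move=> _ [U oU <-]; rewrite setTI.
pose q2r (q : 'rV[rat]_n) : 'rV[R]_n := \row_i ratr (q ord0 i).
pose B (qk : 'rV[rat]_n * nat) : set 'rV[R]_n :=
  [set v | forall i : 'I_n, `|q2r qk.1 ord0 i - v ord0 i| < qk.2.+1%:R^-1].
have mB qk : measurable (g @^-1` B qk).
  rewrite (_ : _ @^-1` _ = \bigcap_(i in [set: 'I_n])
      (fun w => g w ord0 i) @^-1` ball (q2r qk.1 ord0 i) qk.2.+1%:R^-1).
    apply: fin_bigcap_measurable => // i _; rewrite -[X in measurable X]setTI.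
    by apply: (mg i) => //; apply: open_measurable; exact: ball_open.
  by apply/seteqP; split => w /=; [move=> h i _; exact: h|move=> h i; exact: h].
have -> : g @^-1` U = \bigcup_qk (if `[< B qk `<=` U >] then g @^-1` B qk else set0).
  apply/seteqP; split => [w Ugw|w [qk _]]; last first.
    by case: asboolP => // BU /BU.
  have [e /= e0 eU] : exists2 e : R, 0 < e & ball (g w) e `<=` U.
    by apply/nbhs_ballP; exact: open_nbhs_nbhs.
  pose k := Num.truncn (2 / e).
  have ke : k.+1%:R^-1 < e / 2.
    rewrite -[X in _ < X]invf_div ltf_pV2 ?posrE ?divr_gt0//.
    exact: truncnS_gt.
  have k0 : 0 < k.+1%:R^-1 :> R by rewrite invr_gt0.
  set r : R := k.+1%:R^-1 in ke k0; have rE : r = k.+1%:R^-1 by []. clearbody r.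
  have /choice[q qP] : forall i : 'I_n, exists q : rat,
      ratr q \in `](g w ord0 i - r), (g w ord0 i + r)[.
    by move=> i; apply: rat_in_itvoo; lra.
  have Bgw : B (\row_i q i, k) (g w).
    move=> i /=; rewrite -rE !mxE; have := qP i.
    by rewrite in_itv /= => /andP[? ?]; rewrite ltr_norml; apply/andP; split; lra.
  exists (\row_i q i, k) => //; case: asboolP => //; case.
  move=> v Bv; apply: eU; split => // i j; rewrite ord1 /ball /=.
  have := Bv j; have := Bgw j; rewrite /= -rE distrC => h1 h2.
  apply: le_lt_trans (ler_distD (q2r (\row_i0 q i0) ord0 j) _ _) _.
  by move: h1 h2 ke; lra.
by apply: countable_bigcupT_measurable => // qk; case: ifP.
Qed.

Lemma measurable_enorm d (T : measurableType d) (g : T -> 'rV[R]_n) :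
  measurable_fun setT (g : T -> borel_rV R n) ->
  measurable_fun setT (fun w => enorm (g w)).
Proof.
move=> mg; rewrite (_ : (fun w => _) =
    (fun w => (\sum_(i < n) (g w) ord0 i ^+ 2) `^ 2^-1)); last first.
  by apply/funext => w; rewrite powR12_sqrt// sumr_ge0// => i _; exact: sqr_ge0.
apply: (measurableT_comp (measurable_powR _)); apply: measurable_sum => i.
by apply: measurable_funX; exact: measurableT_comp (measurable_coord i) mg.
Qed.

Lemma measurable_rVD d (T : measurableType d) (g h : T -> 'rV[R]_n) :
  measurable_fun setT (g : T -> borel_rV R n) ->
  measurable_fun setT (h : T -> borel_rV R n) ->
  measurable_fun setT ((fun w => g w + h w) : T -> borel_rV R n).
Proof.
move=> mg mh; apply: measurable_fun_rV => i; under eq_fun do rewrite mxE.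
by apply: measurable_funD; exact: measurableT_comp (measurable_coord i) _.
Qed.

Lemma measurable_rVZ d (T : measurableType d) (c : T -> R) (h : T -> 'rV[R]_n) :
  measurable_fun setT c ->
  measurable_fun setT (h : T -> borel_rV R n) ->
  measurable_fun setT ((fun w => c w *: h w) : T -> borel_rV R n).
Proof.
move=> mc mh; apply: measurable_fun_rV => i; under eq_fun do rewrite mxE.
by apply: measurable_funM => //; exact: measurableT_comp (measurable_coord i) _.
Qed.

Lemma measurable_rVB d (T : measurableType d) (g h : T -> 'rV[R]_n) :
  measurable_fun setT (g : T -> borel_rV R n) ->
  measurable_fun setT (h : T -> borel_rV R n) ->
  measurable_fun setT ((fun w => g w - h w) : T -> borel_rV R n).
Proof.
move=> mg mh; apply: measurable_rVD => //; under eq_fun do rewrite -scaleN1r.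
exact: (measurable_rVZ (c := cst _) (measurable_cst _) mh).
Qed.

Lemma continuous_measurable_rV_rV (g : 'rV[R]_n -> 'rV[R]_n) :
  continuous g -> measurable_fun setT (g : borel_rV R n -> borel_rV R n).
Proof.
move=> cg; apply: measurable_fun_rV => i; apply: continuous_measurable_borel_rV.
move=> x; exact: (@continuous_comp _ _ _ g (fun v => v ord0 i) x (cg x)
  (@coord_continuous _ _ _ _ _ _)).
Qed.

End borel_measurability.

Section state_measurability.
Context {R : realType} {n : nat} (d' : measure_display) (Xi : measurableType d').
Variables (G : 'rV[R]_n -> Xi -> 'rV[R]_n) (eta theta : nat -> R) (x0 : 'rV[R]_n).
Hypothesis G_meas : jointly_measurable G.

(** The measurable space [T] is arbitrary, so that it may carry only the events
determined by the first samples: measurability then says that the state is a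
function of these samples. *)
Lemma measurable_pm_state d (T : measurableType d) (s : T -> nat -> Xi) k :
  (forall j, (j < k)%N -> measurable_fun setT (s ^~ j)) ->
  measurable_fun setT
    (fun w => (pm_state G eta theta x0 (s w) k).1 : borel_rV R n) /\
  measurable_fun setT
    (fun w => (pm_state G eta theta x0 (s w) k).2 : borel_rV R n).
Proof.
elim: k => [|k IH] ms; first by split; exact: measurable_cst.
have [mx mm] := IH (fun j jk => ms j (ltnW jk)).
have mG : measurable_fun setT
    (fun w => G (pm_state G eta theta x0 (s w) k).1 (s w k) : borel_rV R n).
  exact: measurableT_comp G_meas (measurable_fun_pair mx (ms k (ltnSn k))).
have mm' : measurable_fun setT
    (fun w => (pm_state G eta theta x0 (s w) k.+1).2 : borel_rV R n).
  exact: (measurable_rVD (measurable_rVZ (c := cst _) (measurable_cst _) mm)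
    (measurable_rVZ (c := cst _) (measurable_cst _) mG)).
split => //; apply: (measurable_rVB mx); apply: (measurable_rVZ _ mm').
apply: measurable_funM => //.
rewrite (_ : (fun w => _) = (fun w => (enorm (pm_state G eta theta x0 (s w) k.+1).2) `^ (-1))).
  exact: measurableT_comp (measurable_powR _) (measurable_enorm mm').
by apply/funext => w; rewrite powR_inv1// enorm_ge0.
Qed.

End state_measurability.

(** * Independence *)

Section independence_theory.
Context {R : realType} {d d' : measure_display} {T : measurableType d}
  {Xi : measurableType d'} (P : probability T R).
Local Open Scope ereal_scope.

(** Conditioning on [S]: since [X] is independent of [S], the law of [(S, X)] is a
product and the integral over [X] can be bounded with [S] frozen. *)
Lemma integral_independent_le d1 d2 (T1 : measurableType d1)
    (T2 : measurableType d2) (S : T -> T1) (X : T -> T2)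
    (phi : T1 * T2 -> \bar R) (psi : T1 -> \bar R) :
  measurable_fun setT S -> measurable_fun setT X ->
  (forall A B, measurable A -> measurable B ->
    P (S @^-1` A `&` X @^-1` B) = P (S @^-1` A) * P (X @^-1` B)) ->
  measurable_fun setT phi -> (forall z, 0 <= phi z) ->
  measurable_fun setT psi ->
  (forall s, \int[P]_v phi (s, X v) <= psi s) ->
  \int[P]_w phi (S w, X w) <= \int[P]_w psi (S w).
Proof.
move=> mS mX SX mphi phi0 mpsi phi_psi.
pose S' : {mfun T >-> T1} := HB.pack S (isMeasurableFun.Build _ _ _ _ S mS).
pose X' : {mfun T >-> T2} := HB.pack X (isMeasurableFun.Build _ _ _ _ X mX).
have mSX : measurable_fun setT (fun w => (S w, X w)) by exact: measurable_fun_pair.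
pose SX' : {mfun T >-> (T1 * T2)%type} :=
  HB.pack (fun w => (S w, X w)) (isMeasurableFun.Build _ _ _ _ _ mSX).
have prodE : forall C, measurable C ->
    (distribution P S' \x distribution P X') C = distribution P SX' C.
  apply: product_measure_unique => A B mA mB.
  by rewrite /distribution /pushforward /= -SX.
have -> : \int[P]_w phi (S w, X w) = \int[distribution P SX']_z phi z.
  by rewrite /distribution ge0_integral_pushforward.
rewrite (@eq_measure_integral _ _ _ _ (distribution P S' \x distribution P X')); last first.
  by move=> C mC _; exact/esym/prodE.
have phi_psi' s : fubini_F (distribution P X') phi s <= psi s.
  rewrite /fubini_F /distribution ge0_integral_pushforward//.
    exact: phi_psi.
  exact: measurable_fun_pair2.
have psi0 s : 0 <= psi s.
  by apply: le_trans (phi_psi' s); exact: integral_ge0.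
rewrite fubini_tonelli1//.
have -> : \int[P]_w psi (S w) = \int[distribution P S']_s psi s.
  by rewrite /distribution ge0_integral_pushforward.
apply: ge0_le_integral => //.
- by move=> s _; exact: integral_ge0.
- exact: measurable_fun_fubini_tonelli_F.
Qed.

Lemma identically_distributed_integral (X Y : {RV P >-> Xi}) (h : Xi -> \bar R) :
  identically_distributed X Y -> measurable_fun setT h -> (forall y, 0 <= h y) ->
  \int[P]_w h (X w) = \int[P]_w h (Y w).
Proof.
move=> XY mh h0.
have pushE (Z : {RV P >-> Xi}) : \int[P]_w h (Z w) = \int[distribution P Z]_y h y.
  by rewrite /distribution ge0_integral_pushforward.
rewrite !pushE; apply: eq_measure_integral => A mA _; exact: XY.
Qed.

Lemma dynkin_independent (B : set T) : measurable B ->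
  dynkin [set E | measurable E /\ P (E `&` B) = P E * P B].
Proof.
move=> mB; split => /=.
- by split => //; rewrite setTI probability_setT mul1e.
- move=> E [mE EB]; split; first exact: measurableC.
  rewrite setIC -setDE measureD//; last by rewrite -ge0_fin_numE// fin_num_measure.
  rewrite [X in _ - X](_ : _ = P (E `&` B)); last by rewrite setIC.
  by rewrite EB probability_setC// muleBl ?fin_num_measure// mul1e.
- move=> F tF FB; have mF n : measurable (F n) by have [] := FB n.
  split; first exact: bigcupT_measurable.
  have tFB : trivIset setT (fun n => F n `&` B).
    apply/trivIsetP => i j _ _ ij; move/trivIsetP : tF => tF.
    by rewrite setIACA tF// set0I.
  rewrite setI_bigcupl !measure_bigcup//; last by move=> n _; exact: measurableI.
  have PB : P B = (fine (P B))%:E by rewrite fineK// fin_num_measure.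
  rewrite muleC PB -nneseriesZl//; apply: eq_eseriesr => n _.
  by have [_ FnB] := FB n; rewrite -PB muleC; exact: FnB.
Qed.

Variable X : nat -> {RV P >-> Xi}.

(** A generating system of the sigma-algebra of the first [k] samples. *)
Definition past (k : nat) : set_system T :=
  \bigcup_(j in `I_k) preimage_set_system [set: T] (X j) measurable.

Hypothesis X_indep : mutually_independent X.

(** The finite cylinders over the first [k] samples form a pi-system that generates
their sigma-algebra; mutual independence is the product rule on cylinders, and it
extends by the pi-lambda theorem. *)
Lemma past_independent k (E : set T) (B : set Xi) :
  <<s past k >> E -> measurable B ->
  P (E `&` X k @^-1` B) = P E * P (X k @^-1` B).
Proof.
move=> pE mB.
have mX j (A : set Xi) : measurable A -> measurable (X j @^-1` A).
  by move=> mA; rewrite -[X in measurable X]setTI; exact: measurable_funP.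
pose cyl : set_system T := [set E | exists2 A : nat -> set Xi,
  (forall j, measurable (A j)) & E = \bigcap_(j in `I_k) X j @^-1` A j].
have past_cyl : past k `<=` cyl.
  move=> _ [j jk [A mA <-]].
  exists (fun i => if i == j then A else setT); first by move=> i; case: ifP.
  rewrite setTI; apply/seteqP; split => [w Aw i _ /=|w /(_ j jk) /=].
    by case: eqP => [->|].
  by rewrite eqxx.
have cylI : setI_closed cyl.
  move=> _ _ [A mA ->] [A' mA' ->]; exists (fun j => A j `&` A' j).
    by move=> j; exact: measurableI.
  by rewrite -bigcapI.
have cylP : cyl `<=` [set E | measurable E /\
    P (E `&` X k @^-1` B) = P E * P (X k @^-1` B)].
  move=> _ [A mA ->]; split.
    by apply: fin_bigcap_measurable => // j _; exact: mX.
  pose J := [fset j in iota 0 k]%fset.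
  have JE : [set` J] = `I_k.
    by apply/seteqP; split => j /=; rewrite !inE mem_iota.
  pose A' j := if j == k then B else A j.
  have mA' j : measurable (A' j) by rewrite /A'; case: ifP.
  have A'E j : (j < k)%N -> A' j = A j by rewrite /A'; case: ltngtP.
  have kJ : k \notin J by rewrite !inE mem_iota ltnn.
  have := X_indep (J := (k |` J)%fset) (fun j _ => mA' j).
  rewrite big_fsetU1//= {2}/A' eqxx muleC -(X_indep (fun j _ => mA' j)).
  have -> : [set` (k |` J)%fset] = [set` J] `|` [set k].
    apply/seteqP; split => j /=.
      by rewrite in_fset1U => /orP[/eqP ->|jJ]; [right|left].
    by move=> [jJ|->]; rewrite in_fset1U ?jJ ?eqxx ?orbT.
  rewrite bigcap_setU bigcap_set1 {2}/A' eqxx JE.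
  rewrite (@eq_bigcapr _ _ _ (fun j => X j @^-1` A' j) (fun j => X j @^-1` A j))//.
  by move=> j /= jk; rewrite A'E.
have [] // : [set E | measurable E /\
    P (E `&` X k @^-1` B) = P E * P (X k @^-1` B)] E.
apply: (@lambda_system_subset _ cyl cylI setT) => //.
- by apply/dynkin_lambda_system; apply: dynkin_independent; exact: mX.
- exact: sub_smallest2r pE.
Qed.

End independence_theory.

(** * Averaging the noise *)

Section noise.
Context {R : realType} {n : nat} {d : measure_display} {T : measurableType d}
  (P : probability T R).
Implicit Types h : T -> R.

Lemma integral_prob_cst (r : R) : (\int[P]_w r%:E = r%:E)%E.
Proof.
have := @integral_cst _ _ _ P setT measurableT r%:E.
by rewrite /= probability_setT mule1.
Qed.

Let centered h := P.-integrable setT (EFin \o h) /\ (\int[P]_w (h w)%:E = 0)%E.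

Let centered_sum (I : Type) (s : seq I) (h : I -> T -> R) :
  (forall i, centered (h i)) -> centered (fun w => \sum_(i <- s) h i w).
Proof.
move=> hc; elim: s => [|i s [ih1 ih2]].
  under eq_fun do rewrite big_nil; split; first exact: integrable0.
  by rewrite integral0_eq.
under eq_fun do rewrite big_cons; have [hi1 hi2] := hc i; split.
  rewrite (_ : _ \o _ = (EFin \o h i) \+ (EFin \o (fun w => \sum_(j <- s) h j w)%R))%E.
    exact: integrableD.
  by apply/funext => w /=; rewrite EFinD.
transitivity (\int[P]_w ((EFin \o h i) \+ (EFin \o (fun w => \sum_(j <- s) h j w)%R)) w)%E.
  by apply: eq_integral => w _ /=; rewrite EFinD.
by rewrite integralD_EFin// [X in (X + _)%E]hi2 [X in (_ + X)%E]ih2 adde0.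
Qed.

Let centeredZ (c : R) h : centered h -> centered (fun w => c * h w).
Proof.
move=> [h1 h2]; split.
  rewrite (_ : _ \o _ = (fun w => c%:E * (EFin \o h) w)%E).
    exact: integrableZl.
  by apply/funext => w /=; rewrite EFinM.
transitivity (\int[P]_w (c%:E * (EFin \o h) w))%E.
  by apply: eq_integral => w _ /=; rewrite EFinM.
by rewrite integralZl// [X in (_ * X)%E]h2 mule0.
Qed.

Variables (V : T -> 'rV[R]_n) (g : 'rV[R]_n) (sigma alpha : R).
Hypothesis mV : measurable_fun setT (V : T -> borel_rV R n).
Hypotheses (alpha_gt1 : 1 < alpha) (alpha_le2 : alpha <= 2).
Hypothesis V_mean : forall i, ('E_P[fun w => V w ord0 i] = (g ord0 i)%:E)%E.
Hypothesis V_moment :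
  ('E_P[fun w => (enorm (V w - g) `^ alpha)%R] <= (sigma `^ alpha)%:E)%E.

Let N w := enorm (V w - g) `^ alpha.

Let mN : measurable_fun setT N.
Proof.
apply: measurableT_comp (measurable_powR _) _; apply: measurable_enorm.
exact: (measurable_rVB mV (measurable_cst _)).
Qed.

Let iN : P.-integrable setT (EFin \o N).
Proof.
apply/integrableP; split; first exact/measurable_EFinP.
rewrite (_ : (\int[P]_x _ = \int[P]_w (N w)%:E)%E).
  by apply: le_lt_trans (ltry (sigma `^ alpha)); move: V_moment; rewrite unlock.
by apply: eq_integral => w _; rewrite /= ger0_norm// powR_ge0.
Qed.

Let centered_coord i : centered (fun w => V w ord0 i - g ord0 i).
Proof.
have mVi : measurable_fun setT (fun w => V w ord0 i).
  exact: measurableT_comp (measurable_coord i) mV.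
have iD : P.-integrable setT (EFin \o (fun w => V w ord0 i - g ord0 i)).
  apply: (@le_integrable _ _ _ _ _ measurableT _ (EFin \o (fun w => 1 + N w))).
  - by apply/measurable_EFinP; apply: measurable_funB.
  - move=> w _ /=; rewrite lee_fin [leRHS]ger0_norm; last first.
      by rewrite addr_ge0// powR_ge0.
    have := ler_coord_enorm (V w - g) i; rewrite !mxE => /le_trans; apply.
    rewrite /N; set t := enorm _; have t0 : 0 <= t := enorm_ge0 _.
    have [t1|t1] := leP t 1; first by rewrite (le_trans t1)// lerDl powR_ge0.
    rewrite -[X in X <= _](powRr1 t0).
    by rewrite (le_trans (ler_powR (ltW t1) (ltW alpha_gt1)))// lerDr.
  - rewrite (_ : _ \o _ = (EFin \o cst 1%R) \+ (EFin \o N))%E.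
      by apply: integrableD => //; exact: finite_measure_integrable_cst.
    by apply/funext => w /=; rewrite EFinD.
split=> //.
have ig := @finite_measure_integrable_cst _ _ _ P setT (g ord0 i) measurableT.
have iVi : P.-integrable setT (EFin \o (fun w => V w ord0 i)).
  rewrite (_ : _ \o _ = (EFin \o (fun w => V w ord0 i - g ord0 i)%R)
                        \+ (EFin \o cst (g ord0 i)))%E.
    exact: integrableD.
  by apply/funext => w /=; rewrite -EFinD subrK.
transitivity (\int[P]_w ((V w ord0 i)%:E - (cst (g ord0 i) w)%:E))%E.
  by apply: eq_integral => w _; rewrite EFinB.
rewrite integralB_EFin//; have := V_mean i; rewrite unlock => ->.
by rewrite [X in (_ - X)%E]integral_prob_cst subee.
Qed.

(** The first-order term of [enorm_powR_normD] is linear in the noise, hence has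
mean zero; only the [alpha]-th moment of the noise remains. *)
Lemma integral_enorm_noise a c : 0 <= c ->
  (\int[P]_w (enorm (a + c *: (V w - g)) `^ alpha)%:E
     <= (enorm a `^ alpha + 2 * (c `^ alpha * sigma `^ alpha))%:E)%E.
Proof.
move=> c0.
pose Z w := alpha * enorm a `^ (alpha - 2) * (c * dotp a (V w - g)).
have [iZ Z0] : centered Z.
  apply/centeredZ/centeredZ; rewrite /dotp.
  rewrite (_ : (fun w => _) =
      fun w => \sum_(i < n) a ord0 i * (V w ord0 i - g ord0 i)).
    by apply: centered_sum => i; apply: centeredZ; exact: centered_coord.
  by apply/funext => w; apply: eq_bigr => i _; rewrite !mxE.
pose A : T -> R := cst (enorm a `^ alpha).
pose N' w := 2 * c `^ alpha * N w.
have iA : P.-integrable setT (EFin \o A) by exact: finite_measure_integrable_cst.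
have iN' : P.-integrable setT (EFin \o N').
  rewrite (_ : _ \o _ = (fun w => (2 * c `^ alpha)%:E * (EFin \o N) w)%E).
    exact: (integrableZl measurableT _ iN).
  by apply/funext => w /=; rewrite EFinM.
have iAZ : P.-integrable setT (EFin \o (A \+ Z)).
  rewrite (_ : _ \o _ = (EFin \o A) \+ (EFin \o Z))%E; first exact: integrableD.
  by apply/funext => w.
have iAZN : P.-integrable setT ((EFin \o (A \+ Z)%R) \+ (EFin \o N'))%E.
  exact: integrableD.
apply: (@le_trans _ _ (\int[P]_w ((EFin \o (A \+ Z)%R) \+ (EFin \o N')) w))%E.
  apply: ge0_le_integral => //.
  - by move=> w _; rewrite lee_fin powR_ge0.
  - apply/measurable_EFinP; apply: measurableT_comp (measurable_powR _) _.
    apply: measurable_enorm; apply: (measurable_rVD (measurable_cst _)).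
    apply: (measurable_rVZ (c := cst _) (measurable_cst _)).
    exact: (measurable_rVB mV (measurable_cst _)).
  - exact: measurable_int iAZN.
  - move=> w _ /=; rewrite -EFinD lee_fin.
    apply: le_trans (enorm_powR_normD _ _ alpha_gt1 alpha_le2) _.
    rewrite dotpZr enormZ (ger0_norm c0) powRM ?enorm_ge0//.
    by rewrite /A /Z /N' /N /= mulrA.
rewrite integralD_EFin// (integralD_EFin measurableT iA iZ).
rewrite [X in (_ + X + _)%E]Z0 adde0 [X in (X + _)%E]integral_prob_cst.
rewrite EFinD; apply: leeD => //.
have -> : (\int[P]_x (EFin \o N') x = (2 * c `^ alpha)%:E * \int[P]_x (EFin \o N) x)%E.
  by rewrite -(integralZl measurableT iN); apply: eq_integral => w _; exact: EFinM.
rewrite mulrA [leRHS]EFinM; apply: lee_wpmul2l.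
  by rewrite lee_fin mulr_ge0// powR_ge0.
by move: V_moment; rewrite unlock.
Qed.

End noise.

(** * One step of the method in expectation *)

Section one_step.
Context {R : realType} {n : nat} {d d' : measure_display}
  {T : measurableType d} {Xi : measurableType d'} (P : probability T R).
Variables (f : 'rV[R]_n -> R) (G : 'rV[R]_n -> Xi -> 'rV[R]_n).
Variables (xi : {RV P >-> Xi}) (xis : nat -> {RV P >-> Xi}).
Variables (f_low L1 sigma alpha : R) (x0 : 'rV[R]_n) (eta theta : nat -> R).
Hypothesis f_C1 : continuously_differentiable f.
Hypothesis G_meas : jointly_measurable G.
Hypothesis f_lowP : forall x, f_low <= f x.
Hypothesis L1_gt0 : 0 < L1.
Hypothesis grad_lip : forall x y,
  enorm (grad f x - grad f y) <= L1 * enorm (x - y).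
Hypotheses (alpha_gt1 : 1 < alpha) (alpha_le2 : alpha <= 2).
Hypothesis G_unbiased : forall x (i : 'I_n),
  'E_P[fun w => G x (xi w) ord0 i]%E = (grad f x ord0 i)%:E.
Hypothesis G_moment : forall x,
  ('E_P[fun w => (enorm (G x (xi w) - grad f x) `^ alpha)%R]
     <= (sigma `^ alpha)%:E)%E.
Hypothesis xis_indep : mutually_independent xis.
Hypothesis xis_law : forall k, identically_distributed (xis k) xi.
Hypothesis eta_gt0 : forall k, 0 < eta k.
Hypotheses (theta_gt0 : forall k, 0 < theta k) (theta_le1 : forall k, theta k <= 1).

Let state k w := pm_state G eta theta x0 (fun j => xis j w) k.
Let iter k w := pm_iterate G eta theta x0 (fun j => xis j w) k.
Let mom k w := pm_momentum G eta theta x0 (fun j => xis j w) k.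

Let measurable_state k :
  measurable_fun setT ((fun w => (state k w).1) : T -> borel_rV R n) /\
  measurable_fun setT ((fun w => (state k w).2) : T -> borel_rV R n).
Proof.
by apply: measurable_pm_state => // j _; exact: measurable_funP.
Qed.

Lemma measurable_iterate k : measurable_fun setT (iter k : T -> borel_rV R n).
Proof. by have [] := measurable_state k. Qed.

Let measurable_mom k : measurable_fun setT (mom k : T -> borel_rV R n).
Proof. by have [] := measurable_state k.+1. Qed.

Lemma measurable_grad :
  measurable_fun setT (grad f : borel_rV R n -> borel_rV R n).
Proof. by apply: continuous_measurable_rV_rV; have [] := f_C1. Qed.

Let measurable_f : measurable_fun setT (f : borel_rV R n -> R).
Proof.
apply: continuous_measurable_borel_rV => x; have [fd _] := f_C1.
exact: differentiable_continuous.
Qed.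

Let measurable_err k :
  measurable_fun setT (fun w => enorm (mom k w - grad f (iter k w)) `^ alpha).
Proof.
apply: measurableT_comp (measurable_powR _) _; apply: measurable_enorm.
apply: (measurable_rVB (measurable_mom k)).
exact: measurableT_comp measurable_grad (measurable_iterate k).
Qed.

Let err k := (\int[P]_w (enorm (mom k w - grad f (iter k w)) `^ alpha)%:E)%E.
Let slope k := (\int[P]_w (enorm (grad f (iter k w)))%:E)%E.
Let gap k := (\int[P]_w (f (iter k w) - f_low)%:E)%E.

Let state_independent_next k (A : set (borel_rV R n * borel_rV R n)) (B : set Xi) :
  measurable A -> measurable B ->
  P (state k @^-1` A `&` xis k @^-1` B) =
    (P (state k @^-1` A) * P (xis k @^-1` B))%E.
Proof.
move=> mA mB; apply: past_independent => //.
pose T' := g_sigma_algebraType (past xis k).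
have [m1 m2] : measurable_fun [set: T'] ((fun w => (state k w).1) : T' -> borel_rV R n)
  /\ measurable_fun [set: T'] ((fun w => (state k w).2) : T' -> borel_rV R n).
  apply: measurable_pm_state => // j jk _ C mC; apply: sub_sigma_algebra.
  by exists j => //; exists C.
have := measurable_fun_pair m1 m2 measurableT mA.
by rewrite setTI (_ : (fun w => _) = state k)//; apply/funext => w; case: (state k w).
Qed.

(** The current sample is independent of the state, so its noise can be averaged
with the state frozen ([integral_enorm_noise]). What remains is the previous
momentum, compared with the gradient at the new iterate. *)
Let err_le_previous k : (err k <=
  \int[P]_w (enorm ((1 - theta_pred theta k) *: ((state k w).2 - grad f (iter k w)))
               `^ alpha)%:E
  + (2 * (theta_pred theta k `^ alpha * sigma `^ alpha))%:E)%E.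
Proof.
set t := theta_pred theta k.
have t0 : 0 <= t by rewrite /t; case: (k) => //= j; exact: ltW.
pose a (s : borel_rV R n * borel_rV R n) : 'rV[R]_n :=
  (1 - t) *: ((s.2 : 'rV[R]_n) - grad f s.1).
have m1 := @measurable_fst _ _ (borel_rV R n) (borel_rV R n).
have m2 := @measurable_snd _ _ (borel_rV R n) (borel_rV R n).
have ma : measurable_fun setT (a : _ -> borel_rV R n).
  apply: (measurable_rVZ (c := cst _) (measurable_cst _)).
  by apply: (measurable_rVB m2); exact: measurableT_comp measurable_grad m1.
pose phi (z : (borel_rV R n * borel_rV R n) * Xi) :=
  (enorm (a z.1 + t *: (G z.1.1 z.2 - grad f z.1.1)) `^ alpha)%:E.
pose psi s := ((enorm (a s) `^ alpha)%:E + (2 * (t `^ alpha * sigma `^ alpha))%:E)%E.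
have mphi : measurable_fun setT phi.
  apply/measurable_EFinP; apply: measurableT_comp (measurable_powR _) _.
  apply: measurable_enorm; apply: measurable_rVD.
    exact: measurableT_comp ma measurable_fst.
  apply: (measurable_rVZ (c := cst _) (measurable_cst _)).
  have mz : measurable_fun setT
      (fun z : (borel_rV R n * borel_rV R n) * Xi => z.1.1).
    exact: measurableT_comp m1 measurable_fst.
  apply: measurable_rVB; last exact: measurableT_comp measurable_grad mz.
  exact: measurableT_comp G_meas (measurable_fun_pair mz measurable_snd).
have mpsi' : measurable_fun setT (fun s => (enorm (a s) `^ alpha)%:E).
  apply/measurable_EFinP; apply: measurableT_comp (measurable_powR _) _.
  exact: measurable_enorm.
have mpsi : measurable_fun setT psi by apply: emeasurable_funD.
have [ms1 ms2] := measurable_state k.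
have mS : measurable_fun setT (state k : T -> borel_rV R n * borel_rV R n).
  have := measurable_fun_pair ms1 ms2.
  by rewrite (_ : (fun w => _) = state k)//; apply/funext => w; case: (state k w).
have h := @integral_independent_le R d T P _ _ (borel_rV R n * borel_rV R n)%type
  Xi (state k) (xis k) phi psi mS.
have mxi Z : measurable_fun setT (Z : {RV P >-> Xi}) by exact: measurable_funP.
have {}h := h (mxi (xis k)) (@state_independent_next k) mphi.
have -> : err k = (\int[P]_w phi (state k w, xis k w))%E.
  apply: eq_integral => w _; congr ((enorm _ `^ _)%:E).
  rewrite /mom /pm_momentum /= -/(state k w) -/t /iter /pm_iterate -/(state k w) /a /=.
  by rewrite !scalerBr scalerBl !scale1r; apply/rowP => i; rewrite !mxE; ring.
apply: le_trans (h _ mpsi _) _.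
- by move=> z; rewrite lee_fin powR_ge0.
- move=> s; have -> : (\int[P]_v phi (s, xis k v) = \int[P]_v phi (s, xi v))%E.
    apply: (identically_distributed_integral (h := fun y => phi (s, y)) (xis_law k)).
      exact: measurableT_comp mphi (pair1_measurable s).
    by move=> y; rewrite lee_fin powR_ge0.
  have mV : measurable_fun setT ((fun w => G s.1 (xi w)) : T -> borel_rV R n).
    exact: measurableT_comp G_meas
      (measurable_fun_pair (measurable_cst (s.1 : borel_rV R n)) (mxi xi)).
  rewrite /psi -EFinD.
  exact: (@integral_enorm_noise R n d T P (fun w => G s.1 (xi w)) (grad f s.1)
    sigma alpha mV alpha_gt1 alpha_le2 (G_unbiased s.1) (G_moment s.1) (a s) t t0).
- set c := 2 * _; have c0 : 0 <= c by rewrite !mulr_ge0// powR_ge0.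
  rewrite -[X in (_ + X)%E](integral_prob_cst P c).
  rewrite -(ge0_integralD P measurableT _ (measurableT_comp mpsi' mS))//.
  by move=> w _; rewrite lee_fin powR_ge0.
Qed.

Lemma err0_le : (err 0 <= (2 * sigma `^ alpha)%:E)%E.
Proof.
apply: le_trans (err_le_previous 0) _.
rewrite [X in (X + _)%E]integral0_eq; last first.
  move=> w _; rewrite /= subrr scale0r enorm0 powR0//.
  by rewrite gt_eqF// (lt_trans ltr01).
by rewrite add0e powR1 mul1r.
Qed.

Let iterS k w : iter k.+1 w = iter k w - (eta k / enorm (mom k w)) *: mom k w.
Proof. by []. Qed.

(** Between two iterates the gradient moves by at most [L1 * eta k]. Convexity of
[x `^ alpha] with the weights [1 - theta k] and [theta k] separates this drift
from the old error, leaving the contraction factor [1 - theta k] on the latter. *)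
Lemma errS_le k : (err k.+1 <= (1 - theta k)%:E * err k +
  (L1 `^ alpha * (eta k `^ alpha * theta k `^ (1 - alpha))
   + 2 * (theta k `^ alpha * sigma `^ alpha))%:E)%E.
Proof.
apply: le_trans (err_le_previous k.+1) _.
rewrite [X in (_ <= _ + X)%E]EFinD addeA leeD2r//.
set t := theta k; have t0 : 0 < t := theta_gt0 k; have t1 : t <= 1 := theta_le1 k.
set C := L1 `^ alpha * _.
have C0 : 0 <= C by rewrite mulr_ge0// ?mulr_ge0// powR_ge0.
rewrite -(integral_prob_cst P C) /err -ge0_integralZl_EFin//; first last.
- by rewrite subr_ge0.
- exact/measurable_EFinP/measurable_err.
- by move=> w _; rewrite lee_fin powR_ge0.
rewrite -ge0_integralD//; first last.
- apply: measurable_funeM; exact/measurable_EFinP/measurable_err.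
- by move=> w _; rewrite -EFinM lee_fin mulr_ge0 ?powR_ge0// subr_ge0.
apply: ge0_le_integral => //.
- by move=> w _; rewrite lee_fin powR_ge0.
- apply/measurable_EFinP; apply: measurableT_comp (measurable_powR _) _.
  apply: measurable_enorm.
  apply: (measurable_rVZ (c := cst _) (measurable_cst _)).
  apply: (measurable_rVB (measurable_mom k)).
  exact: measurableT_comp measurable_grad (measurable_iterate k.+1).
- apply: emeasurable_funD => //.
  by apply: measurable_funeM; exact/measurable_EFinP/measurable_err.
move=> w _; rewrite -EFinM -EFinD lee_fin enormZ ger0_norm ?subr_ge0//.
rewrite -/(mom k w).
have step : enorm (iter k w - iter k.+1 w) <= eta k.
  rewrite iterS opprB addrC subrK enormZ ger0_norm; last first.
    by rewrite divr_ge0 ?enorm_ge0// ltW.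
  have [->|m0] := eqVneq (enorm (mom k w)) 0; first by rewrite mulr0 ltW.
  by rewrite divfK.
have tri : enorm (mom k w - grad f (iter k.+1 w)) <=
    enorm (mom k w - grad f (iter k w)) + L1 * eta k.
  rewrite -[mom k w](subrK (grad f (iter k w))) -addrA.
  apply: le_trans (ler_enormD _ _) _; rewrite addrK lerD2l.
  by apply: le_trans (grad_lip _ _) _; rewrite ler_wpM2l// ltW.
set e := enorm (mom k w - grad f (iter k w)) in tri *.
have e0 : 0 <= e := enorm_ge0 _.
(* the drift, rescaled so that it enters the convex combination with weight [t] *)
pose r := (1 - t) / t * (L1 * eta k).
have u0 : 0 <= 1 - t by rewrite subr_ge0.
have Le0 : 0 <= L1 * eta k by rewrite mulr_ge0// ltW.
have r0 : 0 <= r by rewrite mulr_ge0// divr_ge0// ltW.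
apply: (@le_trans _ _ (((1 - t) * e + t * r) `^ alpha)).
  apply: ge0_ler_powR; rewrite ?nnegrE; first exact: ltW (lt_trans ltr01 _).
  - by rewrite mulr_ge0 ?enorm_ge0.
  - by apply: addr_ge0; apply: mulr_ge0 => //; exact: ltW.
  rewrite (_ : (1 - t) * e + t * r = (1 - t) * (e + L1 * eta k)); last first.
    by rewrite /r; field; rewrite gt_eqF.
  exact: ler_wpM2l.
apply: le_trans (powR_convex2 (ltW alpha_gt1) (ltW t0) t1 e0 r0) _.
have t10 : 0 <= t^-1 by rewrite invr_ge0 ltW.
have [L0 eta0] := (ltW L1_gt0, ltW (eta_gt0 k)).
rewrite lerD2l /r !powRM ?mulr_ge0//.
have tE : t * t^-1 `^ alpha = t `^ (1 - alpha).
  rewrite -[t^-1]powR_inv1 ?(ltW t0)// -powRrM mulN1r.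
  by rewrite -[X in X * _](powRr1 (ltW t0)) powR_mulD.
set a := (1 - t) `^ alpha.
rewrite (_ : t * _ = a * (L1 `^ alpha * (eta k `^ alpha * (t * t^-1 `^ alpha)))); last by ring.
rewrite tE -/C ler_piMl//.
apply: (@le_trans _ _ (1 `^ alpha)); last by rewrite powR1.
apply: ge0_ler_powR; rewrite ?nnegrE//; first exact: ltW (lt_trans ltr01 _).
by rewrite gerBl ltW.
Qed.

(** The error enters [descent_normalized] linearly; [young_powR], with a free
constant [c], trades it for its [alpha]-th power. *)
Lemma gapS_le k (c : R) : 0 < c ->
  (gap k.+1 + (eta k)%:E * slope k <= gap k + c%:E * err k +
   ((alpha - 1) * (2 / alpha) `^ (alpha / (alpha - 1))
      * (eta k `^ (alpha / (alpha - 1)) * c `^ (- (1 / (alpha - 1))))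
    + L1 / 2 * eta k ^+ 2)%:E)%E.
Proof.
move=> c0; set C := _ + _ * eta k ^+ 2.
have C0 : 0 <= C.
  have a0 : 0 <= alpha - 1 by rewrite subr_ge0 ltW.
  have l0 : 0 <= L1 / 2 by rewrite divr_ge0// ltW.
  by apply: addr_ge0; rewrite mulr_ge0// ?sqr_ge0// mulr_ge0// powR_ge0.
have mgap j : measurable_fun setT (fun w => (f (iter j w) - f_low)%:E).
  apply/measurable_EFinP; apply: measurable_funB => //.
  exact: measurableT_comp measurable_f (measurable_iterate j).
have mslope : measurable_fun setT (fun w => (enorm (grad f (iter k w)))%:E).
  apply/measurable_EFinP; apply: measurable_enorm.
  exact: measurableT_comp measurable_grad (measurable_iterate k).
have merr : measurable_fun setT
    (fun w => (enorm (mom k w - grad f (iter k w)) `^ alpha)%:E).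
  exact/measurable_EFinP/measurable_err.
have gap_ge0 j w : (0 <= (f (iter j w) - f_low)%:E)%E.
  by rewrite lee_fin subr_ge0.
rewrite -(integral_prob_cst P C) /gap /slope /err.
rewrite -!ge0_integralZl_EFin//; first last.
- exact: ltW.
- by move=> w _; rewrite lee_fin enorm_ge0.
- exact: ltW.
- by move=> w _; rewrite lee_fin powR_ge0.
have mcerr := measurable_funeM c%:E merr.
have mesl := measurable_funeM (eta k)%:E mslope.
have cerr0 w : (0 <= c%:E * (enorm (mom k w - grad f (iter k w)) `^ alpha)%:E)%E.
  by rewrite mule_ge0// lee_fin ?powR_ge0 ?(ltW c0).
have esl0 w : (0 <= (eta k)%:E * (enorm (grad f (iter k w)))%:E)%E.
  by rewrite mule_ge0// lee_fin ?enorm_ge0 ?(ltW (eta_gt0 k)).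
rewrite -!ge0_integralD//; first last.
- exact: emeasurable_funD.
- by move=> w _; exact: adde_ge0.
apply: ge0_le_integral => //.
- by move=> w _; exact: adde_ge0.
- exact: emeasurable_funD.
- by apply: emeasurable_funD => //; exact: emeasurable_funD.
move=> w _; rewrite -!EFinM -!EFinD lee_fin iterS.
have := @descent_normalized _ _ _ (fun x => f_C1.1 x) _ (ltW L1_gt0) grad_lip
  (iter k w) (mom k w) _ (ltW (eta_gt0 k)).
have := young_powR alpha_gt1 c0 (eta_gt0 k) (enorm_ge0 (mom k w - grad f (iter k w))).
by rewrite /C; lra.
Qed.

End one_step.

(** * The random index *)

Section random_index.
Context {R : realType} {n : nat} {d d' : measure_display}
  {T : measurableType d} {Xi : measurableType d'} (P : probability T R).
Variables (f : 'rV[R]_n -> R) (G : 'rV[R]_n -> Xi -> 'rV[R]_n).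
Variables (xis : nat -> {RV P >-> Xi}) (x0 : 'rV[R]_n) (eta theta : nat -> R).
Hypothesis f_C1 : continuously_differentiable f.
Hypothesis G_meas : jointly_measurable G.
Variables (K : nat) (iota : {RV P >-> nat}).
Hypothesis K_gt0 : (0 < K)%N.
Hypothesis iota_unif : uniform_index K iota.
Hypothesis iota_indep : independent_of_sequence iota xis.

Let iter k w := pm_iterate G eta theta x0 (fun j => xis j w) k.
Let h k w : R := enorm (grad f (iter k w)).

Let miter k : measurable_fun setT (iter k : T -> borel_rV R n).
Proof. exact: (measurable_iterate xis x0 eta theta G_meas k). Qed.

Let mnorm : measurable_fun setT
  (fun x : borel_rV R n => enorm (grad f (x : 'rV[R]_n))).
Proof. by apply: measurable_enorm; exact: measurable_grad. Qed.

Let mh k : measurable_fun setT (h k).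
Proof. exact: measurableT_comp mnorm (miter k). Qed.

Let miota (A : set nat) : measurable (iota @^-1` A).
Proof. by rewrite -[X in measurable X]setTI; exact: measurable_funP. Qed.

Let iota_iter_independent k (A : set (borel_rV R n)) (B : set nat) :
  measurable A -> measurable B ->
  P (iter k @^-1` A `&` iota @^-1` B) = (P (iter k @^-1` A) * P (iota @^-1` B))%E.
Proof.
move=> mA _; rewrite setIC muleC; apply: iota_indep.
pose T' := g_sigma_algebraType
  (\bigcup_k preimage_set_system [set: T] (xis k) measurable).
have [m _] : measurable_fun [set: T'] (iter k : T' -> borel_rV R n) /\
   measurable_fun [set: T'] ((fun w => (pm_state G eta theta x0 (fun j => xis j w) k).2)
     : T' -> borel_rV R n).
  apply: measurable_pm_state => // j jk _ C mC; apply: sub_sigma_algebra.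
  by exists j => //; exists C.
by have := m measurableT _ mA; rewrite setTI.
Qed.

Let iota_lt : P (iota @^-1` [set j | (K <= j)%N]) = 0%E.
Proof.
have E : iota @^-1` [set j | (j < K)%N] = \big[setU/set0]_(j < K) (iota @^-1` [set (j : nat)]).
  rewrite -(bigcup_mkord K (fun j => iota @^-1` [set j])); apply/seteqP; split => w /=.
    by move=> iK; exists (iota w).
  by move=> [j /= jK ->].
have P1 : P (iota @^-1` [set j | (j < K)%N]) = 1%E.
  rewrite E measure_semi_additive_ord//.
  - rewrite (eq_bigr (fun=> (K%:R^-1)%:E)); last by move=> j _; exact: iota_unif.
    rewrite sumEFin sumr_const card_ord -[X in X%:E]mulr_natr mulVf//.
    by rewrite pnatr_eq0 -lt0n.
  - by apply/trivIsetP => i j _ _ ij; apply/seteqP; split => w //= -[-> /ord_inj/eqP];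
      rewrite (negbTE ij).
  - exact: bigsetU_measurable.
have -> : iota @^-1` [set j | (K <= j)%N] = ~` (iota @^-1` [set j | (j < K)%N]).
  by apply/seteqP; split => w /=; [rewrite leqNgt => /negP|move/negP; rewrite -leqNgt].
by rewrite probability_setC// P1 subee.
Qed.

Let measurable_random_index : measurable_fun setT (fun w => h (iota w) w).
Proof.
move=> _ B mB; rewrite setTI.
rewrite (_ : _ @^-1` B = \bigcup_k (iota @^-1` [set k] `&` h k @^-1` B)).
  apply: bigcupT_measurable => k; apply: measurableI => //.
  by rewrite -[X in measurable X]setTI; exact: mh.
apply/seteqP; split => w /=; first by move=> Bw; exists (iota w).
by move=> [k _ [/= <-]].
Qed.

(** Every iterate is a function of the samples, hence independent of the index, so
each value [k] of the index contributes [K%:R^-1] times the expectation at step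
[k]. *)
Lemma expectation_random_index :
  ('E_P[fun w => enorm (grad f (iter (iota w) w))] <=
   \sum_(k < K) K%:R^-1%:E * \int[P]_w (enorm (grad f (iter k w)))%:E)%E.
Proof.
rewrite unlock.
pose phi k (z : borel_rV R n * nat) : \bar R :=
  (enorm (grad f z.1) * \1_[set k] z.2)%:E.
have phi0 k z : (0 <= phi k z)%E by rewrite lee_fin mulr_ge0// enorm_ge0.
have mphi k : measurable_fun setT (phi k).
  apply/measurable_EFinP; apply: measurable_funM.
    exact: measurableT_comp mnorm measurable_fst.
  exact: measurableT_comp (measurable_indic _) measurable_snd.
have mphiw k : measurable_fun setT (fun w => phi k (iter k w, iota w)).
  exact: measurableT_comp (mphi k) (measurable_fun_pair (miter k) (measurable_funP _)).
rewrite (@ge0_ae_eq_integral _ _ _ _ _ _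
  (fun w => \sum_(k < K) phi k (iter k w, iota w))%E)//; first last.
- exists (iota @^-1` [set j | (K <= j)%N]); split => // w /=.
  apply: contra_notP => /negP; rewrite -ltnNge => iK _.
  rewrite (bigD1 (Ordinal iK))//= big1.
    by rewrite adde0 /phi /= indicE mem_set// mulr1.
  move=> j ji; rewrite /phi /= indicE memNset ?mulr0// => /= ij.
  by move/eqP : ji; apply; apply/ord_inj.
- by move=> w _; exact: sume_ge0.
- by move=> w _; rewrite lee_fin enorm_ge0.
- exact: emeasurable_sum.
- exact/measurable_EFinP/measurable_random_index.
rewrite ge0_integral_sum//; apply: lee_sum => k _.
have mnorm' : measurable_fun setT (EFin \o (fun x : borel_rV R n => enorm (grad f x))).
  exact/measurable_EFinP.
rewrite -ge0_integralZl_EFin//; first last.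
- exact/measurable_EFinP/mh.
- by move=> w _; rewrite lee_fin enorm_ge0.
apply: (@integral_independent_le R d T P _ _ (borel_rV R n) nat (iter k) iota (phi k)
  (fun x => K%:R^-1%:E * (enorm (grad f x))%:E)%E (miter k) _
  (@iota_iter_independent k) (mphi k) (phi0 k)).
- exact: measurable_funP.
- exact: measurable_funeM.
- move=> s; rewrite /phi /=.
  under eq_integral do rewrite EFinM.
  rewrite ge0_integralZl_EFin ?enorm_ge0//; last first.
    apply/measurable_EFinP; exact: measurableT_comp (measurable_indic _) _.
  have -> : (\int[P]_v (\1_[set (k : nat)] (iota v) : R)%:E)%E
      = P (iota @^-1` [set (k : nat)]).
    by rewrite -[X in P X]setIT -integral_indic//; apply: eq_integral => v _.
  by rewrite iota_unif// muleC.
Qed.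

End random_index.

(** * Summation and rates *)

Section telescoping.
Context {R : realType}.
Variables (F D g : nat -> \bar R) (eta theta p A B : nat -> R).
Local Open Scope ereal_scope.
Hypothesis D_ge0 : forall k, 0 <= D k.
Hypotheses (p_ge0 : forall k, (0 <= p k)%R) (p_nincr : forall k, (p k.+1 <= p k)%R).
Hypotheses (theta_ge0 : forall k, (0 <= theta k)%R).
Hypotheses (theta_le1 : forall k, (theta k <= 1)%R).
Hypothesis F_step : forall k,
  F k.+1 + (eta k)%:E * g k <= F k + (theta k * p k)%:E * D k + (A k)%:E.
Hypothesis D_step : forall k, D k.+1 <= (1 - theta k)%:E * D k + (B k)%:E.

(** Weighting the errors by [p k] makes their contraction by [1 - theta k] pay
exactly for the term [theta k * p k * D k] of the descent inequality. *)
Lemma potential_telescope K :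
  F K + (p K)%:E * D K + \sum_(k < K) (eta k)%:E * g k <=
  F 0 + (p 0)%:E * D 0 + (\sum_(k < K) (A k + p k * B k))%R%:E.
Proof.
elim: K => [|K IH]; first by rewrite !big_ord0.
rewrite !big_ord_recr /=.
set S := (\sum_(i < K) _)%E in IH *.
have step : (p K.+1)%:E * D K.+1 <= (p K * (1 - theta K))%:E * D K + (p K * B K)%:E.
  apply: (@le_trans _ _ ((p K)%:E * D K.+1)).
    by apply: lee_wpmul2r => //; rewrite lee_fin.
  rewrite EFinM -muleA [(p K * B K)%:E]EFinM -muleDr//; last first.
    exact: fin_num_adde_defl.
  by apply: lee_wpmul2l; rewrite ?lee_fin.
rewrite [X in X <= _](_ : _ = (F K.+1 + (eta K)%:E * g K) + (p K.+1)%:E * D K.+1 + S); last first.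
  by rewrite [S + _]addeC addeACA addeA.
apply: (@le_trans _ _ (F K + (theta K * p K)%:E * D K + (A K)%:E
   + ((p K * (1 - theta K))%:E * D K + (p K * B K)%:E) + S)).
  by apply: leeD2r; exact: leeD.
have pE : (p K)%:E * D K = (theta K * p K)%:E * D K + (p K * (1 - theta K))%:E * D K.
  rewrite -ge0_muleDl ?lee_fin ?mulr_ge0 ?subr_ge0// -EFinD; congr (_%:E * _); ring.
rewrite [X in _ <= _ + X]EFinD addeA.
apply: le_trans (leeD2r _ IH); rewrite pE.
set a := (theta K * p K)%:E * _; set b := (p K * (1 - theta K))%:E * _.
rewrite [X in _ <= _ + X]EFinD.
rewrite le_eqVlt; apply/orP; left; apply/eqP.
by rewrite addeACA [LHS]addeAC [F K + (a + b)]addeA.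
Qed.

End telescoping.

Section rates.
Context {R : realType}.
Implicit Types alpha sigma : R.

Lemma le_powR_root (x r y : R) : 0 < r -> 0 <= y -> x `^ r <= y -> x <= y `^ r^-1.
Proof.
move=> r0 y0 xy; have [x0|x0] := leP x 0; first exact: le_trans x0 (powR_ge0 _ _).
rewrite -[X in X <= _](powRr1 (ltW x0)) -[X in x `^ X](mulfV (lt0r_neq0 r0)) powRrM.
by apply: ge0_ler_powR; rewrite ?nnegrE ?powR_ge0 ?invr_ge0// ltW.
Qed.

(** The threshold on [K] is used through [u = K `^ s], for which it reads
[A * ln A <= u] with [A = 4 * M / (s * eps)]. *)
Lemma log_rate_le (M s eps K : R) : 0 < M -> 0 < s -> 0 < eps -> 0 < K ->
  4 * M / (s * eps) * ln (4 * M / (s * eps)) <= K `^ s ->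
  M * ln K * K `^ (- s) <= eps / 2.
Proof.
move=> M0 s0 e0 K0; set A := 4 * M / (s * eps) => AK.
have A0 : 0 < A by rewrite divr_gt0 ?mulr_gt0.
have u0 : 0 < K `^ s by rewrite powR_gt0.
have := ln_le_of_ge_mul_ln A0 u0 AK; rewrite ln_powR => h.
have {}h : ln K <= 2 * K `^ s / A / s by rewrite ler_pdivlMr// mulrC.
rewrite powRN.
apply: (@le_trans _ _ (M * (2 * K `^ s / A / s) / K `^ s)).
  by rewrite ler_wpM2r ?invr_ge0 ?powR_ge0// ler_wpM2l// ltW.
rewrite le_eqVlt; apply/orP; left; apply/eqP; rewrite /A; field.
by rewrite !gt_eqF.
Qed.

(** The exponent of the weights [p k = k.+1%:R `^ weight_exp alpha]. It equates the
decay of the noise term [p k * theta k `^ alpha] with that of the remainder left by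
Young's inequality, whose exponent in [p k] is negative. *)
Definition weight_exp alpha : R := alpha / 2 + (2 * alpha)^-1 - 5 / 4.

Lemma weight_exp_le0 alpha : 1 < alpha -> alpha <= 2 -> weight_exp alpha <= 0.
Proof.
move=> a1 a2; have a0 : 0 < 4 * alpha by lra.
rewrite -(pmulr_rle0 _ a0).
have -> : 4 * alpha * weight_exp alpha = (2 * alpha - 1) * (alpha - 2).
  by rewrite /weight_exp; field; lra.
by rewrite mulr_ge0_le0; lra.
Qed.

(** With [weight_exp] the noise costs decay like [t `^ (noise_exp alpha - 1)], so
their sum up to [K] grows like [K%:R `^ noise_exp alpha] times a logarithm. *)
Definition noise_exp alpha : R := (2 - alpha) / (4 * alpha).

(** The factor [l] stands for the logarithm: being at least 1, it absorbs the
initial terms and bounds [1 + l] by [2 * l]. *)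
Lemma total_cost_le (S l g s L Lp M k : R) :
  0 <= g -> 0 <= s -> 0 <= L -> 0 <= Lp -> 0 <= M -> 0 <= k -> 1 <= l ->
  S <= ((M + 2 * s) * k + L / 2 + Lp) * (1 + l) ->
  g + 2 * s + S <= l * (2 * (g + s + L / 2 + 3 * Lp) + 2 * (M + 2 * s) * k).
Proof.
move=> g0 s0 L0 Lp0 M0 k0 l1 SK.
have c0 : 0 <= (M + 2 * s) * k by rewrite mulr_ge0// addr_ge0// mulr_ge0.
have h1 : ((M + 2 * s) * k + L / 2 + Lp) * (1 + l)
    <= ((M + 2 * s) * k + L / 2 + Lp) * (2 * l).
  by apply: ler_wpM2l; lra.
have h2 : 1 * (g + 2 * s) <= l * (g + 2 * s) by apply: ler_wpM2r => //; lra.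
have l0 : 0 <= l by lra.
by have := mulr_ge0 l0 Lp0; have := mulr_ge0 l0 g0; lra.
Qed.

Variables alpha sigma L1 : R.
Hypotheses (alpha_gt1 : 1 < alpha) (alpha_le2 : alpha <= 2) (L1_gt0 : 0 < L1).

Let q := weight_exp alpha.
Let beta := noise_exp alpha.
Let M1 : R := (alpha - 1) * (2 / alpha) `^ (alpha / (alpha - 1)).

(** The noise term and the remainder of Young's inequality both have order
[t `^ (noise_exp alpha - 1)], and [t <= K] turns the excess over [t^-1] into
[K `^ noise_exp alpha]. The other two costs, curvature and drift, decay at least
like [t^-1]; for the drift this is [0 <= (alpha - 1) * (2 - alpha)]. *)
Lemma step_cost_le (t K eta theta p : R) : 1 <= t -> t <= K ->
  eta = t `^ (- (3 / 4)) -> theta = t `^ (- (1 / 2)) -> p = t `^ q ->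
  M1 * (eta `^ (alpha / (alpha - 1)) * (theta * p) `^ (- (1 / (alpha - 1))))
    + L1 / 2 * eta ^+ 2
    + p * (L1 `^ alpha * (eta `^ alpha * theta `^ (1 - alpha))
           + 2 * (theta `^ alpha * sigma `^ alpha))
  <= ((M1 + 2 * sigma `^ alpha) * K `^ beta + L1 / 2 + L1 `^ alpha) * t^-1.
Proof.
move=> t1 tK etaE thetaE pE.
have [[a1 a2] l0] := (alpha_gt1, alpha_le2, L1_gt0).
have t0 : 0 < t by lra.
have [a0 b0] : alpha != 0 /\ alpha - 1 != 0 by split; rewrite gt_eqF//; lra.
have beta0 : 0 <= beta by rewrite divr_ge0//; lra.
have E1 : eta `^ (alpha / (alpha - 1)) * (theta * p) `^ (- (1 / (alpha - 1)))
    = t `^ (-1 + beta).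
  rewrite etaE thetaE pE powR_mulD// -!powRrM powR_mulD//; congr (_ `^ _).
  by rewrite /q /beta /weight_exp /noise_exp; field; rewrite a0 b0.
have E2 : eta ^+ 2 = t `^ (- (3 / 2)).
  by rewrite etaE -powR_mulrn ?powR_ge0// -powRrM; congr (_ `^ _); field.
have E3 : p * (eta `^ alpha * theta `^ (1 - alpha))
    = t `^ (alpha / 4 + (2 * alpha)^-1 - 7 / 4).
  rewrite etaE thetaE pE -!powRrM !powR_mulD//; congr (_ `^ _).
  by rewrite /q /weight_exp; field.
have E4 : p * theta `^ alpha = t `^ (-1 + beta).
  rewrite thetaE pE -!powRrM powR_mulD//; congr (_ `^ _).
  by rewrite /q /beta /weight_exp /noise_exp; field.
have tV : t^-1 = t `^ (-1) by rewrite powR_inv1// ltW.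
have B1 : t `^ (-1 + beta) <= K `^ beta * t^-1.
  rewrite -powR_mulD// -tV mulrC ler_wpM2r ?invr_ge0 ?(ltW t0)//.
  by apply: ge0_ler_powR => //; rewrite nnegrE; lra.
have B2 : t `^ (- (3 / 2)) <= t^-1 by rewrite tV ler_powR//; lra.
have B3 : t `^ (alpha / 4 + (2 * alpha)^-1 - 7 / 4) <= t^-1.
  rewrite tV ler_powR// -subr_ge0.
  have a40 : 0 < 4 * alpha by lra.
  rewrite -(pmulr_rge0 _ a40).
  have -> : 4 * alpha * (-1 - (alpha / 4 + (2 * alpha)^-1 - 7 / 4))
    = (alpha - 1) * (2 - alpha) by field.
  by rewrite mulr_ge0; lra.
have -> : p * (L1 `^ alpha * (eta `^ alpha * theta `^ (1 - alpha))
           + 2 * (theta `^ alpha * sigma `^ alpha))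
  = L1 `^ alpha * (p * (eta `^ alpha * theta `^ (1 - alpha)))
    + 2 * sigma `^ alpha * (p * theta `^ alpha) by ring.
rewrite E1 E2 E3 E4.
have M10 : 0 <= M1 by rewrite mulr_ge0 ?powR_ge0//; lra.
have L0 : 0 <= L1 / 2 by lra.
have S0 : 0 <= 2 * sigma `^ alpha by rewrite mulr_ge0 ?powR_ge0.
have := ler_wpM2l M10 B1; have := ler_wpM2l S0 B1.
have := ler_wpM2l L0 B2; have := ler_wpM2l (powR_ge0 L1 alpha) B3.
move: (t `^ _) (t `^ _) (t `^ _) (K `^ _) (L1 `^ _) (sigma `^ _) t^-1 => *.
by lra.
Qed.

End rates.

Theorem theorem2 (R : realType) (n : nat) (d d' : measure_display)
  (T : measurableType d) (Xi : measurableType d') (P : probability T R)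
  (f : 'rV[R]_n -> R) (G : 'rV[R]_n -> Xi -> 'rV[R]_n)
  (xi : {RV P >-> Xi}) (xis : nat -> {RV P >-> Xi})
  (f_low L1 sigma alpha : R) (x0 : 'rV[R]_n) (eta theta : nat -> R)
  (f_C1 : continuously_differentiable f)
  (f_min : exists xstar, forall x, f xstar <= f x)
  (G_meas : jointly_measurable G)
  (f_lowP : forall x, f_low <= f x)
  (L1_gt0 : 0 < L1)
  (grad_lip : forall x y,
     enorm (grad f x - grad f y) <= L1 * enorm (x - y))
  (sigma_gt0 : 0 < sigma) (alpha_gt1 : 1 < alpha) (alpha_le2 : alpha <= 2)
  (G_unbiased : forall x (i : 'I_n),
     'E_P[fun w => G x (xi w) ord0 i]%E = (grad f x ord0 i)%:E)
  (G_moment : forall x,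
     ('E_P[fun w => (enorm (G x (xi w) - grad f x) `^ alpha)%R]
        <= (sigma `^ alpha)%:E)%E)
  (xis_indep : mutually_independent xis)
  (xis_law : forall k, identically_distributed (xis k) xi)
  (etaE : forall k, eta k = 1 / k.+1%:R `^ (3 / 4))
  (thetaE : forall k, theta k = 1 / k.+1%:R `^ (1 / 2))
  (m_neq0 : {ae P, forall w, forall k,
     pm_momentum G eta theta x0 (fun j => xis j w) k != 0}) :
  let Mt := M_tilde (f x0 - f_low) L1 sigma alpha in
  let Mh := M_hat sigma alpha in
  forall eps : R, 0 < eps -> eps < 1 ->
  forall K : nat,
    Num.max
      (Num.max
         ((16 * Mt / eps * ln (16 * Mt / eps)) ^+ 4)
         ((8 * alpha * Mh / ((alpha - 1) * eps)
             * ln (8 * alpha * Mh / ((alpha - 1) * eps)))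
            `^ (2 * alpha / (alpha - 1))))
      3 <= K%:R ->
  forall iota : {RV P >-> nat},
    uniform_index K iota -> independent_of_sequence iota xis ->
    ('E_P[fun w => enorm (grad f
        (pm_iterate G eta theta x0 (fun j => xis j w) (iota w)))]
       <= eps%:E)%E.
Proof.
move=> Mt Mh eps eps0 eps1 K.
rewrite !ge_max => /andP[/andP[K1 K2] K3] iota iota_unif iota_indep.
have K0 : (0 < K)%N by rewrite -(ltr0n R); lra.
have kR0 : 0 < (K%:R : R) by rewrite ltr0n.
have al0 : 0 < alpha by lra.
have b0 : 0 < alpha - 1 by lra.
pose t k : R := k.+1%:R.
have t0 k : 0 < t k by rewrite ltr0n.
have t1 k : 1 <= t k by rewrite ler1n.
have etaE' k : eta k = t k `^ (- (3 / 4)) by rewrite etaE div1r powRN.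
have thetaE' k : theta k = t k `^ (- (1 / 2)) by rewrite thetaE div1r powRN.
have eta_gt0 k : 0 < eta k by rewrite etaE' powR_gt0.
have theta_gt0 k : 0 < theta k by rewrite thetaE' powR_gt0.
have theta_le1 k : theta k <= 1.
  by rewrite thetaE' -[leRHS](powRr0 (t k)) ler_powR//; lra.
pose p k := t k `^ weight_exp alpha.
have p_gt0 k : 0 < p k by rewrite powR_gt0.
have p_nincr k : p k.+1 <= p k.
  have q0 : 0 <= - weight_exp alpha by rewrite oppr_ge0 weight_exp_le0.
  have pE j : p j = (t j `^ (- weight_exp alpha))^-1 by rewrite powRN invrK.
  rewrite !pE lef_pV2 ?posrE ?powR_gt0//.
  by apply: ge0_ler_powR; rewrite ?nnegrE ?ler0n// ler_nat.
pose iter k w := pm_iterate G eta theta x0 (fun j => xis j w) k.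
pose mom k w := pm_momentum G eta theta x0 (fun j => xis j w) k.
pose gap k := (\int[P]_w (f (iter k w) - f_low)%:E)%E.
pose err k := (\int[P]_w (enorm (mom k w - grad f (iter k w)) `^ alpha)%:E)%E.
pose slope k := (\int[P]_w (enorm (grad f (iter k w)))%:E)%E.
have slope0 k : (0 <= slope k)%E.
  by apply: integral_ge0 => w _; rewrite lee_fin enorm_ge0.
have gap_ge0 k : (0 <= gap k)%E.
  by apply: integral_ge0 => w _; rewrite lee_fin subr_ge0.
have err_ge0 k : (0 <= err k)%E.
  by apply: integral_ge0 => w _; rewrite lee_fin powR_ge0.
pose M1 : R := (alpha - 1) * (2 / alpha) `^ (alpha / (alpha - 1)).
pose A k := M1 * (eta k `^ (alpha / (alpha - 1))
    * (theta k * p k) `^ (- (1 / (alpha - 1)))) + L1 / 2 * eta k ^+ 2.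
pose B k := L1 `^ alpha * (eta k `^ alpha * theta k `^ (1 - alpha))
   + 2 * (theta k `^ alpha * sigma `^ alpha).
have gap_step k : (gap k.+1 + (eta k)%:E * slope k
    <= gap k + (theta k * p k)%:E * err k + (A k)%:E)%E.
  by apply: gapS_le => //; rewrite mulr_gt0.
have err_step k : (err k.+1 <= (1 - theta k)%:E * err k + (B k)%:E)%E.
  exact: (errS_le x0 f_C1 G_meas L1_gt0 grad_lip alpha_gt1 alpha_le2 G_unbiased
    G_moment xis_indep xis_law eta_gt0 theta_gt0 theta_le1).
have err0 : (err 0%N <= (2 * sigma `^ alpha)%:E)%E.
  exact: (err0_le x0 eta f_C1 G_meas alpha_gt1 alpha_le2 G_unbiased
    G_moment xis_indep xis_law theta_gt0).
have tele := @potential_telescope R gap err slope eta theta p A B err_ge0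
  (fun k => ltW (p_gt0 k)) p_nincr (fun k => ltW (theta_gt0 k)) theta_le1
  gap_step err_step K.
set S : R := \sum_(k < K) (A k + p k * B k) in tele.
pose C := f x0 - f_low + 2 * sigma `^ alpha + S.
have sum_slope : (\sum_(k < K) (eta k)%:E * slope k <= C%:E)%E.
  apply: (@le_trans _ _ (gap 0%N + (p 0%N)%:E * err 0%N + S%:E)%E).
    apply: le_trans tele; rewrite leeDr// adde_ge0// mule_ge0// lee_fin.
    exact: ltW.
  rewrite /C !EFinD leeD2r//; apply: leeD.
    by rewrite /gap (integral_prob_cst P (f x0 - f_low)) EFinD.
  by rewrite /p /t powR1 mul1e.
have SK : S <= ((M1 + 2 * sigma `^ alpha) * K%:R `^ noise_exp alpha
    + L1 / 2 + L1 `^ alpha) * (1 + ln K%:R).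
  have c0 : 0 <= (M1 + 2 * sigma `^ alpha) * K%:R `^ noise_exp alpha
      + L1 / 2 + L1 `^ alpha.
    have l0 : 0 <= L1 / 2 by lra.
    have m0 : 0 <= M1 by rewrite mulr_ge0 ?powR_ge0// ltW.
    have s0 : 0 <= M1 + 2 * sigma `^ alpha by rewrite addr_ge0// mulr_ge0// powR_ge0.
    by rewrite addr_ge0 ?powR_ge0// addr_ge0// mulr_ge0// powR_ge0.
  apply: le_trans (ler_wpM2l c0 (harmonic_le_ln (R := R) K0)).
  rewrite mulr_sumr; apply: ler_sum => k _; rewrite /A /B.
  have kK : t k <= K%:R by rewrite ler_nat.
  exact: (step_cost_le sigma alpha_gt1 alpha_le2 L1_gt0 (t1 k) kK
    (etaE' k) (thetaE' k) erefl).
have lnK1 := ln_ge1 K3.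
have CK : C <= ln K%:R * (Mt + Mh * K%:R `^ noise_exp alpha).
  have gap0 : 0 <= f x0 - f_low by rewrite subr_ge0.
  have s0 := powR_ge0 sigma alpha; have l0 := powR_ge0 L1 alpha.
  have m0 : 0 <= M1 by rewrite mulr_ge0 ?powR_ge0// ltW.
  have k0 := powR_ge0 (K%:R : R) (noise_exp alpha).
  rewrite /C /Mt /Mh /M_tilde /M_hat -/M1.
  by apply: total_cost_le => //; exact: ltW.
(* [K^-1 = K `^ (- (1 / 4)) * K `^ (- (3 / 4))], and the last factor is at most
   every step size used *)
have avg : (\sum_(k < K) K%:R^-1%:E * slope k <= (K%:R `^ (- (1 / 4)) * C)%:E)%E.
  apply: (@le_trans _ _ ((K%:R `^ (- (1 / 4)))%:E * \sum_(k < K) (eta k)%:E * slope k)%E).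
    rewrite ge0_sume_distrr; last first.
      by move=> k _; rewrite mule_ge0// lee_fin ltW.
    apply: lee_sum => k _; rewrite muleA -EFinM; apply: lee_wpmul2r => //.
    rewrite lee_fin etaE' (_ : K%:R^-1 = K%:R `^ (- (1 / 4)) * K%:R `^ (- (3 / 4))); last first.
      by rewrite powR_mulD// -powR_inv1 ?ltW//; congr (_ `^ _); field.
    rewrite ler_wpM2l ?powR_ge0// !powRN lef_pV2 ?posrE ?powR_gt0//.
    by apply: ge0_ler_powR; rewrite ?nnegrE ?ler0n ?ler_nat//; lra.
  by rewrite EFinM; apply: lee_wpmul2l => //; rewrite lee_fin powR_ge0.
have Mt0 : 0 < Mt.
  have gap0 : 0 <= f x0 - f_low by rewrite subr_ge0.
  have s0 := powR_ge0 sigma alpha; have l0 := powR_ge0 L1 alpha.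
  by rewrite /Mt /M_tilde; lra.
have Mh0 : 0 < Mh.
  rewrite /Mh /M_hat mulr_gt0// ltr_pwDl// ?mulr_ge0 ?powR_ge0//.
  by rewrite mulr_gt0// powR_gt0// divr_gt0.
have rate1 : Mt * ln K%:R * K%:R `^ (- (1 / 4)) <= eps / 2.
  have q0 : 0 < 1 / 4 :> R by lra.
  apply: (log_rate_le Mt0 q0 eps0 kR0).
  have -> : 4 * Mt / (1 / 4 * eps) = 16 * Mt / eps by field; rewrite gt_eqF.
  set x := _ * ln _ in K1 *; have [x0'|x_gt0] := leP x 0.
    exact: le_trans x0' (powR_ge0 _ _).
  have -> : 1 / 4 = 4^-1 :> R by field.
  by apply: le_powR_root => //; rewrite ?ler0n// powR_mulrn// ltW.
have rate2 : Mh * ln K%:R * K%:R `^ (- ((alpha - 1) / (2 * alpha))) <= eps / 2.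
  have s0 : 0 < (alpha - 1) / (2 * alpha) by rewrite divr_gt0// mulr_gt0.
  apply: (log_rate_le Mh0 s0 eps0 kR0).
  have -> : 4 * Mh / ((alpha - 1) / (2 * alpha) * eps)
      = 8 * alpha * Mh / ((alpha - 1) * eps) by field; rewrite !gt_eqF.
  have -> : (alpha - 1) / (2 * alpha) = (2 * alpha / (alpha - 1))^-1 by rewrite invf_div.
  by apply: le_powR_root; rewrite ?ler0n// divr_gt0// mulr_gt0.
apply: le_trans (expectation_random_index x0 eta theta f_C1 G_meas K0 iota_unif iota_indep) _.
apply: le_trans avg _; rewrite lee_fin.
apply: le_trans (ler_wpM2l (powR_ge0 _ _) CK) _.
have -> : K%:R `^ (- (1 / 4)) * (ln K%:R * (Mt + Mh * K%:R `^ noise_exp alpha))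
  = Mt * ln K%:R * K%:R `^ (- (1 / 4))
    + Mh * ln K%:R * (K%:R `^ (- (1 / 4)) * K%:R `^ noise_exp alpha) by ring.
rewrite powR_mulD//.
have -> : - (1 / 4) + noise_exp alpha = - ((alpha - 1) / (2 * alpha)).
  by rewrite /noise_exp; field; rewrite gt_eqF.
by rewrite [leRHS]splitr lerD.
Qed.
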